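(* Let $K$ be a field of characteristic different from $2$ with $K\ne K(\varepsilon_2)$, let $G=\langle g\rangle$ be a cyclic group of order $2^n$, let $K_tG$ be the twisted group algebra of $G$ over $K$ defined by $\bar g^{2^n}=a\in K^*$, and let $H_n(a)=s$. Then the minimal idempotents of $K_tG$ are as follows. 1) If $s=0$, then $K_tG$ has a unique minimal idempotent, which is equal to the identity element. 2) If at least one of the following conditions is fulfilled: (a) $K$ is of type C, $s\ge 1$ and $a\in (K^* )^{2^s}$; (b) $K$ is of type D or E, $1\le s\le m-1$ and $a\in (K^* )^{2^s}$; then, writing $a=b^{2^s}$ with $b\in K^*$, the minimal idempotents are $$e_0=\frac1{2^s}\sum_{j=0}^{2^s-1}(b^{-1}\bar g^{\,2^{n-s}})^j,\qquad e_{2^{s-1}}=\frac1{2^s}\sum_{j=0}^{2^s-1}(-1)^j(b^{-1}\bar g^{\,2^{n-s}})^j,$$ $$e_i=\frac1{2^s}\sum_{j=0}^{2^s-1}(\varepsilon_s^{ij}+\varepsilon_s^{-ij})(b^{-1}\bar g^{\,2^{n-s}})^j,\qquad i=1,2,\ldots,2^{s-1}-1.$$ 3) If $K$ is of type D or E, $s\ge m$ and $a\in (K^* )^{2^s}$, then, writing $a=b^{2^s}$ with $b\in K^*$ and setting $\lambda=1$ if $K$ is of type D and $\lambda=-1$ if $K$ is of type E, the minimal idempotents are $$e_0=\frac1{2^s}\sum_{j=0}^{2^s-1}(b^{-1}\bar g^{\,2^{n-s}})^j,\qquad e_{2^{m-2}}=\frac1{2^s}\sum_{j=0}^{2^s-1}(-1)^j(b^{-1}\bar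 g^{\,2^{n-s}})^j,$$ $$e_i=\frac1{2^s}\sum_{j=0}^{2^s-1}(\varepsilon_{m-1}^{ij}+\varepsilon_{m-1}^{-ij})(b^{-1}\bar g^{\,2^{n-s}})^j,\qquad i=1,2,\ldots,2^{m-2}-1,$$ $$e_{ri}=\frac1{2^{s-r}}\sum_{j=0}^{2^{s-r}-1}(\varepsilon_m^{-j}\varepsilon_{m-2}^{-ij}+\lambda^{-j}\varepsilon_m^{j}\varepsilon_{m-2}^{ij})(b^{-2^r}\bar g^{\,2^{n-s+r}})^j,\qquad r=0,1,\ldots,s-m,\ \ i=0,1,\ldots,2^{m-2}-1.$$ 4) If at least one of the following conditions is fulfilled: (a) $K$ is of type C, $s\ge 1$ and $a\in -(K^* )^{2^s}$; (b) $K$ is of type D or E, $1\le s\le m-1$ and $a\in -(K^* )^{2^s}$; then, writing $a=-b^{2^s}$ with $b\in K^*$ and setting $\lambda=-1$ if $K$ is of type E and $s=m-1$, and $\lambda=1$ in all other cases, the minimal idempotents are $$e_i=\frac1{2^s}\sum_{j=0}^{2^s-1}(\varepsilon_{s+1}^{-j}\varepsilon_{s-1}^{-ij}+\lambda^{-j}\varepsilon_{s+1}^{j}\varepsilon_{s-1}^{ij})(b^{-1}\bar g^{\,2^{n-s}})^j,\qquad i=0,1,2,\ldots,2^{s-1}-1.$$ 5) If $K$ is of type D, $s\ge m$ and $a\in(1+\varepsilon_m)^{2^s}(K^* )^{2^s}$, then, writing $a=b^{2^s}(1+\varepsilon_m)^{2^s}$ with $b\in K^*$, the minimal idempotents are $$e_i=\frac1{2^s}\sum_{j=0}^{2^s-1}(1+\varepsilon_m)^{-j}(\varepsilon_{m-1}^{-ij}+\varepsilon_m^{j}\varepsilon_{m-1}^{ij})(b^{-1}\bar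 g^{\,2^{n-s}})^j,\qquad i=0,1,2,\ldots,2^{m-1}-1;$$ if $s\ge m+1$, also $$e_{1,2^{m-1}-1}=\frac1{2^{s-1}}\sum_{j=0}^{2^{s-1}-1}(2+\varepsilon_m+\varepsilon_m^{-1})^{-j}(b^{-2}\bar g^{\,2^{n-s+1}})^j,$$ $$e_{1,2^{m-2}-1}=\frac1{2^{s-1}}\sum_{j=0}^{2^{s-1}-1}(-1)^j(2+\varepsilon_m+\varepsilon_m^{-1})^{-j}(b^{-2}\bar g^{\,2^{n-s+1}})^j;$$ if $s\ge m+1$ and $m\ge 3$, also $$e_{1,i}=\frac1{2^{s-1}}\sum_{j=0}^{2^{s-1}-1}(2+\varepsilon_m+\varepsilon_m^{-1})^{-j}(\varepsilon_{m-1}^{-j(1+i)}+\varepsilon_{m-1}^{j(1+i)})(b^{-2}\bar g^{\,2^{n-s+1}})^j,\qquad i=0,1,\ldots,2^{m-2}-2;$$ and if $s\ge m+2$, also $$e_{ri}=\frac1{2^{s-r}}\sum_{j=0}^{2^{s-r}-1}(1+\varepsilon_m)^{-j2^r}(\varepsilon_m^{-j}\varepsilon_{m-2}^{-ij}+\varepsilon_m^{j}\varepsilon_{m-2}^{j(i+2^{r-2})})(b^{-2^r}\bar g^{\,2^{n-s+r}})^j,\qquad r=2,3,\ldots,s-m,\ \ i=0,1,\ldots,2^{m-2}-1.$$ In each case the displayed list is the list of all minimal idempotents of $K_tG$.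
   Context: For each integer $k\ge 0$, $\varepsilon_k$ denotes a primitive $2^k$-th root of $1$ in a fixed algebraic closure $\bar K$ of $K$ (so $\varepsilon_0=1$, $\varepsilon_1=-1$), chosen compatibly: $\varepsilon_{k+1}^2=\varepsilon_k$ for all $k\geq 0$. $K^*$ is the multiplicative group of $K$ and $(K^* )^{2^s}=\{u^{2^s}\mid u\in K^*\}$. Types. A field $K$ of characteristic different from $2$ with $K\ne K(\varepsilon_2)$ is said to be: - of type C if $\varepsilon_k+\varepsilon_k^{-1}\in K$ for every natural $k$; - of type D if there exists a (unique) natural $m\ge 2$ such that $\varepsilon_m+\varepsilon_m^{-1}\in K$, $\varepsilon_{m+1}+\varepsilon_{m+1}^{-1}\notin K$ and $\varepsilon_{m+1}-\varepsilon_{m+1}^{-1}\notin K$; - of type E if there exists a (unique) natural $m\ge 3$ such that $\varepsilon_m-\varepsilon_m^{-1}\in K$. For $K$ of type D or E, $m$ always denotes the integer in this definition (the constant of $K$ with respect to $2$). Twisted group algebra. A twisted group algebra $K_tG$ of a group $G$ over $K$ is an associative $K$-algebra with $K$-basis $\{\bar x\mid x\in G\}$ and multiplication $\bar x\,\bar y=\gamma(x,y)\overline{xy}$, $\gamma(x,y)\in K^*$. If $G=\langle g\rangle$ is cyclic of order $2^n$, then $\bar g^{2^n}=a$ (meaning $a$ times the identity) for some $a\in K^*$, and this equality determines $K_tG$ (it is the commutative algebra $K[x]/(x^{2^n}-a)$ with $x\mapsto\bar g$); we say that the equality defines $K_tG$. Height. For an integer $s\ge 0$ let $K_s=K^*\cap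 (K(\varepsilon_2)^* )^{2^s}$. $H_n(a)$ denotes the greatest integer $s\in[0,n]$ such that $a\in K_s$. A minimal idempotent of a commutative algebra is a nonzero idempotent that is not a sum of two nonzero orthogonal idempotents. The coefficients in the displayed formulas, written as elements of $K(\varepsilon_2)$, lie in $K$. *)

(* Defs.v *)
From HB Require Import structures.
From mathcomp Require Import all_boot all_order all_algebra all_fingroup all_field.
From Stdlib Require List.

Set Implicit Arguments.
Unset Strict Implicit.
Unset Printing Implicit Defensive.

Import GRing.Theory.
Local Open Scope ring_scope.

Section Subfields.

(* An algebraic closure of K is a closed field Kbar together with an embedding
   emb : K -> Kbar over which every element of Kbar is algebraic; K and its
   intermediate extensions are handled as predicates on Kbar. *)
Variables (K : fieldType) (Kbar : closedFieldType) (emb : {rmorphism K -> Kbar}).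

Definition in_base (z : Kbar) : Prop := exists c : K, z = emb c.

(* K(x), as the set of all values at x of rational functions over K *)
Definition in_adjoin (x z : Kbar) : Prop :=
  exists p q : {poly K},
    (map_poly emb q).[x] != 0 /\
    z = (map_poly emb p).[x] / (map_poly emb q).[x].

Definition compatible_roots (eps : nat -> Kbar) : Prop :=
  forall k, (2 ^ k)%N.-primitive_root (eps k) /\ eps k.+1 ^+ 2 = eps k.

Variable eps : nat -> Kbar.

Definition base_neq_adjoin_eps2 : Prop :=
  ~ (forall z, in_base z <-> in_adjoin (eps 2) z).

(* The standing assumptions (characteristic different from 2, and
   [base_neq_adjoin_eps2]) are not repeated in the three types below. *)
Definition typeC : Prop := forall k, in_base (eps k + (eps k)^-1).

Definition typeD (m : nat) : Prop :=
  [/\ (2 <= m)%N,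
      in_base (eps m + (eps m)^-1),
      ~ in_base (eps m.+1 + (eps m.+1)^-1)
    & ~ in_base (eps m.+1 - (eps m.+1)^-1)].

Definition typeE (m : nat) : Prop :=
  (3 <= m)%N /\ in_base (eps m - (eps m)^-1).

(* a lies in the intersection of K^* and (K(eps_2)^* )^(2^s). *)
Definition in_Ks (s : nat) (a : K) : Prop :=
  a != 0 /\
  exists u : Kbar, [/\ in_adjoin (eps 2) u, u != 0 & emb a = u ^+ (2 ^ s)].

(* H_n(a) = s *)
Definition height_eq (n : nat) (a : K) (s : nat) : Prop :=
  [/\ (s <= n)%N, in_Ks s a & forall t, (t <= n)%N -> in_Ks t a -> (t <= s)%N].

End Subfields.

(* [bar] is only relevant on G. The unit of A need not be [bar 1]. *)
Definition is_twisted_group_algebra (K : fieldType) (gT : finGroupType)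
    (G : {group gT}) (A : falgType K) (bar : gT -> A) : Prop :=
  basis_of {:A}%VS [seq bar x | x in G] /\
  exists gamma : gT -> gT -> K,
    {in G &, forall x y,
       gamma x y != 0 /\ bar x * bar y = gamma x y *: bar (x * y)%g}.

Definition minimal_idempotent (A : nzRingType) (e : A) : Prop :=
  [/\ e != 0, e * e = e
    & ~ exists e1 e2 : A,
        [/\ e1 != 0 /\ e2 != 0, e1 * e1 = e1, e2 * e2 = e2,
            e1 * e2 = 0 /\ e2 * e1 = 0 & e = e1 + e2]].

(* [Avg N c y] stands for the formula
     (1 / N) * \sum_(0 <= j < N) c_j y ^ j
   with y in a K-algebra A and coefficients c_j written as elements of Kbar. *)
Record avg (Kbar A : Type) := Avg {
  avg_size : nat;
  avg_coef : nat -> Kbar;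
  avg_base : A
}.

(* e is the element of A given by the formula f; this includes the claim that
   the coefficients of f lie in K. Such an e is unique, emb being injective. *)
Definition denotes (K : fieldType) (Kbar : closedFieldType)
    (emb : {rmorphism K -> Kbar}) (A : falgType K) (f : avg Kbar A) (e : A) :
    Prop :=
  exists c : nat -> K,
    (forall j, (j < avg_size f)%N -> emb (c j) = avg_coef f j) /\
    e = (avg_size f)%:R^-1 *: \sum_(j < avg_size f) c j *: avg_base f ^+ j.

(* The formulas in fs enumerate, without repetition, all minimal idempotents. *)
Definition minimal_idempotents_are (K : fieldType) (Kbar : closedFieldType)
    (emb : {rmorphism K -> Kbar}) (A : falgType K) (fs : seq (avg Kbar A)) :
    Prop :=
  exists es : seq A,
    [/\ List.Forall2 (@denotes K Kbar emb A) fs es, uniq es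
      & forall e : A, minimal_idempotent e <-> e \in es].

(* Main.v *)
Require Import Defs.
From HB Require Import structures.
From mathcomp Require Import all_boot all_order all_algebra all_fingroup all_field.
From mathcomp Require Import ring.
From Stdlib Require Classical_Prop.

Set Implicit Arguments.
Unset Strict Implicit.
Unset Printing Implicit Defensive.

Import GRing.Theory.
Local Open Scope ring_scope.

(** Put x = bar g and let R be the set of the 2^n roots of X^(2^n) - a in Kbar.
    The powers of x below 2^n form a basis of A and these roots are distinct,
    so p(x) = 0 exactly when p vanishes on R: sending p(x) to the restriction of
    p to R identifies A with a ring of functions on R.  Its idempotents are the
    indicator functions it contains, and since a polynomial over K that vanishes
    at a root vanishes at the conjugates of that root, the minimal idempotents
    are the indicators of the classes of K-conjugate roots
    ([minimal_idempotents_of_indicators]).  A list of formulas is therefore the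
    right one as soon as each formula is the indicator of a set of mutually
    conjugate roots and these sets partition R.

    Indicators.  If y^N = beta^N, then (1/N) sum_(j < N) (y / beta)^j is 1 or 0
    according as y = beta or not ([geometric_average]).  So each formula of the
    theorem is the indicator of the roots t for which a multiple of a power
    t^(2^k) lies in a set {beta, beta'} of at most two values.

    Conjugacy.  In all cases beta lies in L = K(i), where i = eps 2, and beta' is
    its image under the automorphism of L over K, so the roots in question are
    2^k-th roots of an element alpha of L and of its conjugate.  If alpha is not
    a square in L, each of the k square roots to be taken doubles the degree:
    because L contains i, a square root of a nonsquare of L is a nonsquare of
    the field it generates ([adjoin_sqrt_nonsquare]).  Hence all these roots are
    conjugate over K ([root_K_conjugate]).  That alpha is not a square has one
    of two reasons.  At level r = 0 a square root of alpha would raise the height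
    of a.  For r > 0 alpha is a square of L times a primitive 2^m-th root of
    unity, and in types D and E no such root of unity is a square in L
    ([typeDE_nonsquare]).

    Partition.  Let t^(2^(n-s)) / b = tau.  The number of formulas of a list that
    take the value 1 at t is a sum of indicators of conditions tau^(2^r) = beta.
    Summing over a coset of a group of roots of unity of order Q turns it into
    the indicator of one condition on tau^(2Q) ([sum_eq_coset_pair],
    [sum_eq_inverse_pair]), and the conditions of the different levels r add up
    by [z = 1] + [z = -1] = [z^2 = 1] ([sum_expN1]) to the condition that
    t^(2^n) = a, which all roots satisfy. *)

(** * Square roots and conjugacy over K *)

Section SquareRoots.

Variables (K : fieldType) (Kbar : closedFieldType) (emb : {rmorphism K -> Kbar}).

(** Intermediate fields are kept as predicates on Kbar, so that towers of
    extensions need no new field structures and no embeddings between them. *)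
Definition subextension (S : Kbar -> Prop) : Prop :=
  [/\ forall c, S (emb c), forall x y, S x -> S y -> S (x + y),
      forall x y, S x -> S y -> S (x * y) & forall x, S x -> S x^-1].

Definition adjoin_sqrt (S : Kbar -> Prop) (g z : Kbar) : Prop :=
  exists u v, [/\ S u, S v & z = u + v * g].

Lemma subextensionN S x : subextension S -> S x -> S (- x).
Proof. by case=> Sc _ SM _ Sx; rewrite -mulN1r -(rmorphN1 emb); apply: SM. Qed.

Lemma adjoin_sqrt_inj S g u v : subextension S -> ~ S g -> S u -> S v ->
  u + v * g = 0 -> u = 0 /\ v = 0.
Proof.
move=> sS gS Su Sv uv0; have [v0|v_neq0] := eqVneq v 0.
  by move: uv0; rewrite v0 mul0r addr0.
case: gS; have -> : g = - u * v^-1.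
  by apply: (mulfI v_neq0); rewrite mulrCA divff // mulr1 (addr0_eq uv0) mulrC.
have [_ _ SM SV] := sS; apply: SM; [exact: subextensionN | exact: SV].
Qed.

Lemma adjoin_sqrt_sub S g z : subextension S -> S z -> adjoin_sqrt S g z.
Proof.
case=> Sc _ _ _ Sz; exists z, 0; split=> //; last by rewrite mul0r addr0.
by rewrite -(rmorph0 emb).
Qed.

Lemma adjoin_sqrt_subextension S g :
  subextension S -> S (g ^+ 2) -> ~ S g -> subextension (adjoin_sqrt S g).
Proof.
move=> sS Sg2 gS; have [Sc SD SM SV] := sS; split.
- by move=> c; apply: adjoin_sqrt_sub.
- move=> x y [u [v [Su Sv ->]]] [u' [v' [Su' Sv' ->]]].
  exists (u + u'), (v + v'); split; try exact: SD; ring.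
- move=> x y [u [v [Su Sv ->]]] [u' [v' [Su' Sv' ->]]].
  exists (u * u' + v * v' * g ^+ 2), (u * v' + v * u').
  split; [apply: SD (SM _ _ _ _) (SM _ _ (SM _ _ _ _) Sg2) | | ring] => //.
  by apply: SD; apply: SM.
move=> x [u [v [Su Sv ->]]].
have [uv0|uv_neq0] := eqVneq (u + v * g) 0.
  rewrite uv0 invr0; exists 0, 0; split; first 2 last.
  - by rewrite mul0r addr0.
  - by rewrite -(rmorph0 emb).
  - by rewrite -(rmorph0 emb).
have SNv : S (- v) by apply: subextensionN.
have uv'_neq0 : u + - v * g != 0.
  apply: contraNneq uv_neq0 => /(adjoin_sqrt_inj sS gS Su SNv)[-> /eqP].
  by rewrite oppr_eq0 => /eqP->; rewrite mul0r addr0.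
have Nu : u ^+ 2 - v ^+ 2 * g ^+ 2 != 0.
  by rewrite -exprMn subr_sqr mulf_neq0 -?mulNr.
pose d := (u ^+ 2 - v ^+ 2 * g ^+ 2)^-1.
have Sd : S d.
  apply: SV; apply: SD; first exact: SM.
  by apply: (subextensionN sS); apply: (SM) => //; apply: (SM).
exists (u * d), (- v * d); split; do ?exact: SM.
by rewrite /d; field; rewrite exprMn Nu uv_neq0.
Qed.

(** If g = (u + v g)^2 with u, v in S, comparing coordinates gives
    u^2 = - v^2 g^2 and 2 u v = 1, so g = +- i u / v would already be in S:
    this is where -1 has to be a square in S. *)
Lemma adjoin_sqrt_nonsquare S (i g : Kbar) : 2%:R != 0 :> Kbar ->
    subextension S -> S i -> i ^+ 2 = -1 -> S (g ^+ 2) -> ~ S g ->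
  forall v, adjoin_sqrt S g v -> v ^+ 2 <> g.
Proof.
move=> two_neq0 sS Si i2 Sg2 gS _ [u [v [Su Sv ->]]] E; have [Sc SD SM SV] := sS.
have uv0 : (u ^+ 2 + v ^+ 2 * g ^+ 2) + (2%:R * (u * v) - 1) * g = 0.
  by rewrite -[RHS](subrr g) -{3}E; ring.
have Suv0 : S (u ^+ 2 + v ^+ 2 * g ^+ 2).
  by apply: (SD); [apply: (SM) | apply: (SM (v ^+ 2)) => //; apply: (SM)].
have Suv1 : S (2%:R * (u * v) - 1).
  apply: (SD); last by rewrite -(rmorphN1 emb).
  by rewrite -(rmorph_nat emb); apply: (SM) => //; apply: (SM).
case: (adjoin_sqrt_inj sS gS Suv0 Suv1 uv0) => {Suv0 Suv1}uv0 /eqP.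
rewrite subr_eq0 => /eqP uv1.
have v0 : v != 0.
  by apply/eqP=> v0; move: uv1 (oner_neq0 Kbar); rewrite v0 !mulr0 => <-; rewrite eqxx.
have /eqP : g ^+ 2 = (i * u * v^-1) ^+ 2.
  apply: (mulfI (expf_neq0 2 v0)); rewrite !exprMn i2 exprVn.
  have -> : v ^+ 2 * (-1 * u ^+ 2 * v ^- 2) = - u ^+ 2 by field.
  by apply/eqP; rewrite -addr_eq0 addrC uv0.
have Siuv : S (i * u * v^-1) by apply: (SM); [apply: (SM) | apply: SV].
rewrite eqf_sqr => /orP[]/eqP gE; apply: gS; rewrite gE //.
exact: subextensionN.
Qed.

(** Taking k square roots of a nonsquare of S one after the other, each step is
    a proper quadratic extension whose generator is again a nonsquare. *)
Lemma sqrt_tower k S (i t : Kbar) : 2%:R != 0 :> Kbar ->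
    subextension S -> S i -> i ^+ 2 = -1 -> S (t ^+ (2 ^ k)) ->
    (forall v, S v -> v ^+ 2 <> t ^+ (2 ^ k)) ->
  exists F, [/\ subextension F, F t & forall v, F v -> v ^+ 2 <> t].
Proof.
move=> two_neq0; elim: k S => [|k IHk] S sS Si i2 St nsq; first by exists S.
have E : (t ^+ (2 ^ k)) ^+ 2 = t ^+ (2 ^ k.+1) by rewrite -exprM expnSr.
have gS : ~ S (t ^+ (2 ^ k)) by move/nsq; rewrite E.
rewrite -E in St.
apply: (IHk (adjoin_sqrt S (t ^+ (2 ^ k)))) => //.
- exact: adjoin_sqrt_subextension.
- exact: adjoin_sqrt_sub.
- have [Sc _ _ _] := sS; exists 0, 1; rewrite mul1r add0r; split=> //.
  + by rewrite -(rmorph0 emb).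
  + by rewrite -(rmorph1 emb).
- exact: (adjoin_sqrt_nonsquare two_neq0 sS Si i2 St gS).
Qed.

Lemma subextension_horner S (p : {poly K}) z :
  subextension S -> S z -> S (map_poly emb p).[z].
Proof.
case=> Sc SD SM _ Sz; elim/poly_ind: p => [|p c IHp].
  by rewrite rmorph0 horner0 -(rmorph0 emb).
by rewrite rmorphD rmorphM /= map_polyX map_polyC hornerMXaddC; exact: SD (SM _ _ IHp Sz) (Sc c).
Qed.

Definition K_conjugate (z z' : Kbar) : Prop :=
  forall q : {poly K}, (map_poly emb q).[z] = 0 -> (map_poly emb q).[z'] = 0.

(** Split q into its even and odd parts, q(t) = e(t^2) + t o(t^2).  The tower
    built up to t^2 contains e(t^2) and o(t^2) but not t, so q(t) = 0 forces both
    to vanish, and induction applies to e and o at t^2. *)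
Lemma root_K_conjugate k S (i t t' : Kbar) : 2%:R != 0 :> Kbar ->
    subextension S -> S i -> i ^+ 2 = -1 -> S (t ^+ (2 ^ k)) ->
    ((0 < k)%N -> forall v, S v -> v ^+ 2 <> t ^+ (2 ^ k)) ->
    K_conjugate (t ^+ (2 ^ k)) (t' ^+ (2 ^ k)) ->
  K_conjugate t t'.
Proof.
move=> two_neq0 sS Si i2; elim: k t t' => // k IHk t t' St nsq tt' q.
have E z : z ^+ (2 ^ k.+1) = (z ^+ 2) ^+ (2 ^ k) by rewrite -exprM expnS.
rewrite !E in St nsq tt'.
have IH := IHk _ _ St (fun _ => nsq isT) tt'.
have [F [sF Ft2 Fnsq]] := sqrt_tower two_neq0 sS Si i2 St (nsq isT).
have Ft : ~ F t by move/Fnsq.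
have hE z : (map_poly emb q).[z] = (map_poly emb (even_poly q)).[z ^+ 2]
                                   + (map_poly emb (odd_poly q)).[z ^+ 2] * z.
  rewrite -{1}[q]poly_even_odd rmorphD rmorphM /= !map_comp_poly /= map_polyXn map_polyX.
  by rewrite hornerD hornerM hornerX !horner_comp hornerXn.
rewrite !hE => /(adjoin_sqrt_inj sF Ft (subextension_horner _ sF Ft2)
                  (subextension_horner _ sF Ft2))[/IH-> /IH->].
by rewrite mul0r addr0.
Qed.

End SquareRoots.

(** * The conjugation of K(i) *)

Section Conjugation.

Variables (K : fieldType) (Kbar : closedFieldType) (emb : {rmorphism K -> Kbar}).
Variable i : Kbar.
Hypotheses (i2 : i ^+ 2 = -1) (i_notin : ~ in_base emb i).

(** The graph of the nontrivial automorphism of K(i) over K.  As a relation it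
    needs no extension to the rest of Kbar. *)
Definition conj_pair (z z' : Kbar) : Prop :=
  exists u v : K, z = emb u + emb v * i /\ z' = emb u - emb v * i.

Lemma base_subextension : subextension emb (in_base emb).
Proof.
split=> [c | x y [c ->] [d ->] | x y [c ->] [d ->] | x [c ->]].
- by exists c.
- by exists (c + d); rewrite rmorphD.
- by exists (c * d); rewrite rmorphM.
- by exists c^-1; rewrite fmorphV.
Qed.

Lemma base_adjoin_i_subextension : subextension emb (adjoin_sqrt (in_base emb) i).
Proof.
apply: adjoin_sqrt_subextension base_subextension _ i_notin.
by rewrite i2 -(rmorphN1 emb); exists (-1).
Qed.

Lemma base_coord_inj (u v : K) : emb u + emb v * i = 0 -> u = 0 /\ v = 0.
Proof.
case/(adjoin_sqrt_inj base_subextension i_notin); try by [exists u | exists v].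
by move=> /eqP + /eqP; rewrite !fmorph_eq0 => /eqP-> /eqP->.
Qed.

Lemma conj_pairP z : adjoin_sqrt (in_base emb) i z <-> exists z', conj_pair z z'.
Proof.
split=> [[_ [_ [[u ->] [v ->] ->]]] | [z' [u [v [-> _]]]]].
  by exists (emb u - emb v * i), u, v.
by exists (emb u), (emb v); split=> //; [exists u | exists v].
Qed.

Lemma conj_pair_adjoin z z' : conj_pair z z' -> adjoin_sqrt (in_base emb) i z.
Proof. by move=> zz'; apply/conj_pairP; exists z'. Qed.

Lemma conj_pair_base c : conj_pair (emb c) (emb c).
Proof. by exists c, 0; rewrite rmorph0 mul0r addr0 subr0. Qed.

Lemma conj_pair1 : conj_pair 1 1.
Proof. by rewrite -(rmorph1 emb); apply: conj_pair_base. Qed.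

Lemma conj_pairN1 : conj_pair (-1) (-1).
Proof. by rewrite -(rmorphN1 emb); apply: conj_pair_base. Qed.

Lemma conj_pair_i : conj_pair i (- i).
Proof. by exists 0, 1; rewrite rmorph0 rmorph1 mul1r add0r sub0r. Qed.

Lemma conj_pair_sym z z' : conj_pair z z' -> conj_pair z' z.
Proof.
by case=> u [v [-> ->]]; exists u, (- v); rewrite rmorphN mulNr opprK.
Qed.

Lemma conj_pairD z z' w w' :
  conj_pair z z' -> conj_pair w w' -> conj_pair (z + w) (z' + w').
Proof.
case=> u [v [-> ->]] [s [t [-> ->]]]; exists (u + s), (v + t).
by rewrite !rmorphD; split; ring.
Qed.

Lemma conj_pairM z z' w w' :
  conj_pair z z' -> conj_pair w w' -> conj_pair (z * w) (z' * w').
Proof.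
case=> u [v [-> ->]] [s [t [-> ->]]]; exists (u * s - v * t), (u * t + v * s).
rewrite rmorphB rmorphD !rmorphM; split.
  transitivity (emb u * emb s + emb v * emb t * i ^+ 2
                + (emb u * emb t + emb v * emb s) * i); first by ring.
  by rewrite i2; ring.
transitivity (emb u * emb s + emb v * emb t * i ^+ 2
                - (emb u * emb t + emb v * emb s) * i); first by ring.
by rewrite i2; ring.
Qed.

Lemma conj_pairX z z' k : conj_pair z z' -> conj_pair (z ^+ k) (z' ^+ k).
Proof.
move=> zz'; elim: k => [|k IHk]; first exact: conj_pair1.
by rewrite !exprS; apply: conj_pairM.
Qed.

Lemma conj_pair_uniq z z' z'' : conj_pair z z' -> conj_pair z z'' -> z' = z''.
Proof.
case=> u [v [-> ->]] [s [t [E ->]]].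
have : emb (u - s) + emb (v - t) * i = 0.
  by move/eqP: E; rewrite -subr_eq0 => /eqP <-; rewrite !rmorphB; ring.
by case/base_coord_inj=> /eqP + /eqP; rewrite !subr_eq0 => /eqP-> /eqP->.
Qed.

Lemma conj_pairV z z' : conj_pair z z' -> conj_pair z^-1 z'^-1.
Proof.
move=> zz'; have [z0|z_neq0] := eqVneq z 0.
  have -> : z' = 0.
    by apply: conj_pair_uniq zz' _; rewrite z0 -(rmorph0 emb); apply: conj_pair_base.
  by rewrite z0 invr0 -(rmorph0 emb); apply: conj_pair_base.
have [_ _ _ LV] := base_adjoin_i_subextension.
have /conj_pairP[w zVw] := LV _ (conj_pair_adjoin zz').
have E : z' * w = 1.
  by apply: conj_pair_uniq (conj_pairM zz' zVw) _; rewrite divff //; apply: conj_pair1.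
have z'_neq0 : z' != 0.
  by apply: contraTneq (oner_neq0 Kbar) => z'0; rewrite -E z'0 mul0r eqxx.
suff -> : z'^-1 = w by [].
by apply: (mulfI z'_neq0); rewrite E divff.
Qed.

Lemma conj_pair_trace z z' : conj_pair z z' -> in_base emb (z + z').
Proof. by case=> u [v [-> ->]]; exists (u + u); rewrite rmorphD; ring. Qed.

Lemma conj_pair_horner (q : {poly K}) z z' : conj_pair z z' ->
  conj_pair (map_poly emb q).[z] (map_poly emb q).[z'].
Proof.
move=> zz'; elim/poly_ind: q => [|q c IHq].
  by rewrite rmorph0 !horner0 -(rmorph0 emb); apply: conj_pair_base.
rewrite rmorphD rmorphM /= map_polyX map_polyC !hornerMXaddC.
exact: conj_pairD (conj_pairM IHq zz') (conj_pair_base c).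
Qed.

Lemma conj_pair_K_conjugate z z' : conj_pair z z' -> K_conjugate emb z z'.
Proof.
move=> zz' q qz; apply: conj_pair_uniq (conj_pair_horner q zz') _.
by rewrite qz -(rmorph0 emb); apply: conj_pair_base.
Qed.

(** w and w' are the two roots of a quadratic polynomial over K, so the same
    pair A, B of elements of K gives w^k = A + B w and w'^k = A + B w'.  Since
    w^k = i is not in K, B is nonzero and both equations can be solved for w
    and w'. *)
Lemma conj_pair_quadratic k w w' : in_base emb (w + w') -> in_base emb (w * w') ->
  w ^+ k = i -> w' ^+ k = - i -> conj_pair w w'.
Proof.
case=> s sE [p pE].
have linear_power l : exists A B : K,
    w ^+ l = emb A + emb B * w /\ w' ^+ l = emb A + emb B * w'.
  elim: l => [|l [A [B [IH IH']]]].
    by exists 1, 0; rewrite rmorph1 rmorph0 !mul0r addr0.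
  exists (- (B * p)), (A + B * s); rewrite !exprS IH IH' rmorphN rmorphD !rmorphM -sE -pE.
  by split; ring.
have [A [B [-> ]]] := linear_power k.
have [->|B0] := eqVneq B 0.
  by rewrite rmorph0 !mul0r !addr0 => _ Ai; case: i_notin; exists A.
move=> -> E E'; have eB0 : emb B != 0 by rewrite fmorph_eq0.
exists (- (A / B)), B^-1; rewrite rmorphN fmorph_div fmorphV; split.
  by rewrite -E; field.
by rewrite -[i]opprK -E'; field.
Qed.

End Conjugation.

(** * The algebra as functions on the roots of X^N - a *)

Section PowerBasis.

Variables (K : fieldType) (Kbar : closedFieldType) (emb : {rmorphism K -> Kbar}).
Variables (A : falgType K) (x : A) (N : nat) (a : K) (zeta : Kbar).
Hypotheses (N_gt0 : (0 < N)%N) (a_neq0 : a != 0) (zeta_prim : N.-primitive_root zeta).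
Hypothesis x_basis : basis_of {:A}%VS [seq x ^+ j | j <- iota 0 N].
Hypothesis xN : x ^+ N = a%:A.

Notation val q t := (map_poly emb q).[t].

Lemma power_root_exists (c : Kbar) k : (0 < k)%N -> exists t, t ^+ k = c.
Proof.
move=> k_gt0; have /closed_rootP[t] : size ('X^k - c%:P) != 1%N.
  by rewrite size_XnsubC // eqSS -lt0n.
by rewrite /root !hornerE subr_eq0 => /eqP; exists t.
Qed.

Lemma horner_alg_surj y : exists q : {poly K}, horner_alg x q = y.
Proof.
have /(coord_span (X := in_tuple _)) -> : y \in <<[seq (x ^+ j)%R | j <- iota 0 N]>>%VS.
  by rewrite (span_basis x_basis) memvf.
set X := in_tuple _.
exists (\sum_(j < size X) coord X j y *: 'X^j).
rewrite rmorph_sum; apply: eq_bigr => j _ /=.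
rewrite linearZ /= rmorphXn /= horner_algX.
have jN : (j < N)%N by apply: leq_trans (ltn_ord j) _; rewrite size_map size_iota.
by rewrite (nth_map 0%N) ?size_iota // nth_iota // mulr_algl.
Qed.

(** Both sides say that X^N - a divides q: the left one by the independence of
    the powers of x, the right one because X^N - a has N distinct roots. *)
Lemma horner_alg_eq0 q :
  horner_alg x q = 0 <-> forall t, t ^+ N = emb a -> val q t = 0.
Proof.
have P_monic : 'X^N - a%:P \is monic by rewrite monicE lead_coefXnsubC.
have size_P : size ('X^N - a%:P) = N.+1 by rewrite size_XnsubC.
have embP : map_poly emb ('X^N - a%:P) = 'X^N - (emb a)%:P.
  by rewrite rmorphB /= map_polyXn map_polyC.
suff : horner_alg x q = 0 <-> 'X^N - a%:P %| q.
  move=> ->; rewrite -(dvdp_map emb) embP; split=> [/dvdpP[r ->] t tN|q0].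
    by rewrite !hornerE tN subrr mulr0.
  have [t0 t0N] := power_root_exists (emb a) N_gt0.
  have t0_neq0 : t0 != 0.
    by apply: contraNneq a_neq0 => t00; rewrite -(fmorph_eq0 emb) -t0N t00 expr0n -leqn0 leqNgt N_gt0.
  (* The distinct roots are one root times all powers of zeta. *)
  pose rs := [seq t0 * zeta ^+ j | j <- iota 0 N].
  have rsN t : t \in rs -> t ^+ N = emb a.
    by case/mapP=> j _ ->; rewrite exprMn t0N -exprM mulnC exprM (prim_expr_order zeta_prim) expr1n mulr1.
  have rs_uniq : uniq rs.
    rewrite map_inj_in_uniq ?iota_uniq // => j k; rewrite !mem_iota /= !add0n => jN kN.
    move/(mulfI t0_neq0)/eqP; rewrite (eq_prim_root_expr zeta_prim).
    by rewrite !modn_small // => /eqP.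
  have -> : 'X^N - (emb a)%:P = \prod_(z <- rs) ('X - z%:P).
    rewrite (all_roots_prod_XsubC (rs := rs) (p := 'X^N - (emb a)%:P)).
    - by rewrite lead_coefXnsubC // scale1r.
    - by rewrite size_XnsubC // size_map size_iota.
    - by apply/allP=> t /rsN tN; rewrite /root !hornerE tN subrr.
    - by rewrite uniq_rootsE.
  by apply: uniq_roots_dvdp; rewrite ?uniq_rootsE //; apply/allP=> t /rsN/q0/eqP.
have P0 : horner_alg x ('X^N - a%:P) = 0.
  by rewrite rmorphB rmorphXn /= horner_algX horner_algC xN subrr.
split=> [|/dvdpP[r ->]]; last by rewrite rmorphM /= P0 mulr0.
rewrite /dvdp {1}(divp_eq q ('X^N - a%:P)) rmorphD rmorphM /= P0 mulr0 add0r.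
set r := q %% _ => r0; apply/eqP.
have size_r : (size r <= N)%N by rewrite -ltnS -size_P ltn_modp monic_neq0.
have sizeX : size [seq x ^+ j | j <- iota 0 N] = N by rewrite size_map size_iota.
have /freeP freeX : free (in_tuple [seq x ^+ j | j <- iota 0 N]) by apply: basis_free x_basis.
apply/polyP=> j; rewrite coef0.
have [jN|Nj] := ltnP j N; last by rewrite nth_default // (leq_trans size_r).
rewrite -sizeX in jN.
apply: (freeX (fun j => r`_j) _ (Ordinal jN)).
rewrite -[RHS]r0 -[in RHS](coefK r) (poly_def (size r)) rmorph_sum /=.
rewrite sizeX (big_ord_widen N (fun j => horner_alg x (r`_j *: 'X^j))) // [RHS]big_mkcond /=.
apply: eq_bigr => l _; rewrite linearZ /= rmorphXn /= horner_algX.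
rewrite (nth_map 0%N) ?size_iota // nth_iota //.
case: ltnP => [_|rl]; first by rewrite mulr_algl.
by rewrite (nth_default _ rl) scale0r.
Qed.

Lemma horner_alg_ext q r :
  (forall t, t ^+ N = emb a -> val q t = val r t) -> horner_alg x q = horner_alg x r.
Proof.
move=> qr; apply/eqP; rewrite -subr_eq0 -rmorphB; apply/eqP/horner_alg_eq0 => t tN.
by rewrite rmorphB hornerD hornerN qr // subrr.
Qed.

Lemma horner_alg_inj_on q r t :
  t ^+ N = emb a -> horner_alg x q = horner_alg x r -> val q t = val r t.
Proof.
move=> tN qr; have /horner_alg_eq0/(_ t tN) : horner_alg x (q - r) = 0.
  by rewrite rmorphB /= qr subrr.
by rewrite rmorphB hornerD hornerN => /subr0_eq.
Qed.

Definition conjugacy_indicator (p : {poly K}) : Prop :=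
  [/\ forall t, t ^+ N = emb a -> val p t = 0 \/ val p t = 1,
      exists2 t, t ^+ N = emb a & val p t = 1
    & forall t t', t ^+ N = emb a -> t' ^+ N = emb a ->
        val p t = 1 -> val p t' = 1 -> K_conjugate emb t t'].

Lemma idempotent_val q t : t ^+ N = emb a ->
  horner_alg x q * horner_alg x q = horner_alg x q -> val q t = 0 \/ val q t = 1.
Proof.
move=> tN; rewrite -rmorphM => /(horner_alg_inj_on tN) /eqP.
rewrite rmorphM hornerM -subr_eq0 -{3}[val q t]mulr1 -mulrBr mulf_eq0 subr_eq0.
by case/orP=> /eqP ->; [left | right].
Qed.

Lemma idempotent_neq0_val q : horner_alg x q != 0 ->
  horner_alg x q * horner_alg x q = horner_alg x q ->
  exists2 t, t ^+ N = emb a & val q t = 1.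
Proof.
move=> q_neq0 qq; have [t0 t0N] := power_root_exists (emb a) N_gt0.
apply: Classical_Prop.NNPP => no_t.
case/eqP: q_neq0; apply/horner_alg_eq0 => t tN.
by case: (idempotent_val tN qq) => // q1; case: no_t; exists t.
Qed.

(** An idempotent takes only the values 0 and 1 at the roots, and by conjugacy
    it is constant on each of the sets indicated by ps.  So none of these
    indicators splits, and an idempotent that is 1 at some root lies above the
    indicator of the set containing that root. *)
Lemma minimal_idempotents_of_indicators (ps : seq {poly K}) :
    (forall p, p \in ps -> conjugacy_indicator p) ->
    (forall t, t ^+ N = emb a -> count (fun p => val p t != 0) ps = 1%N) ->
  let es := [seq horner_alg x p | p <- ps] in
  uniq es /\ forall e, minimal_idempotent e <-> e \in es.
Proof.
move=> ps_ind ps_count /=.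
have idem p : p \in ps -> horner_alg x p * horner_alg x p = horner_alg x p.
  case/ps_ind=> p01 _ _; rewrite -rmorphM; apply: horner_alg_ext => t /p01.
  by rewrite rmorphM hornerM => -[]->; rewrite ?mulr0 ?mulr1.
have neq0 p : p \in ps -> horner_alg x p != 0.
  case/ps_ind=> _ [t tN p1] _; apply/eqP=> /horner_alg_eq0/(_ t tN)/eqP.
  by rewrite p1 oner_eq0.
split.
  have {ps_count} : forall t, t ^+ N = emb a -> (count (fun p => (val p t != 0)%R) ps <= 1)%N.
    by move=> t /ps_count->.
  elim: ps ps_ind {idem neq0} => //= p ps IHps ps_ind ps_count; apply/andP; split.
    apply/mapP=> -[r r_ps pr]; have [_ [t tN p1] _] := ps_ind p (mem_head _ _).
    have := ps_count t tN; rewrite p1 oner_eq0 /= add1n ltnS leqNgt -has_count.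
    case/negP; apply/hasP; exists r => //.
    by rewrite -(horner_alg_inj_on tN pr) p1 oner_eq0.
  apply: IHps => [r r_ps|t tN]; first by apply: ps_ind; rewrite inE r_ps orbT.
  by apply: leq_trans (ps_count t tN); rewrite leq_addl.
move=> e; split=> [[e_neq0 ee e_min]|/mapP[p p_ps ->]].
  have [q qe] := horner_alg_surj e; rewrite -{}qe in e_neq0 ee e_min *.
  have [t tN q1] := idempotent_neq0_val e_neq0 ee.
  have : has (fun p => val p t != 0) ps by rewrite has_count ps_count.
  case/hasP=> p p_ps p_neq0; have [p01 _ p_conj] := ps_ind p p_ps.
  have p1 : val p t = 1 by case: (p01 t tN) p_neq0 => // ->; rewrite eqxx.
  (* q is 1 on the whole set of p, so q = p + (q - p) is an orthogonal
     decomposition. *)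
  have pq : horner_alg x p * horner_alg x q = horner_alg x p.
    rewrite -rmorphM; apply: horner_alg_ext => t' t'N; rewrite rmorphM hornerM.
    case: (p01 t' t'N) => [->|p1']; first by rewrite mul0r.
    have /(p_conj _ _ tN t'N p1 p1') : val (1 - q) t = 0.
      by rewrite rmorphB rmorph1 hornerD hornerN hornerC q1 subrr.
    rewrite rmorphB rmorph1 hornerD hornerN hornerC => /subr0_eq <-.
    by rewrite mulr1.
  have qp : horner_alg x q * horner_alg x p = horner_alg x p.
    by rewrite -rmorphM mulrC rmorphM.
  have [->|qp_neq] := eqVneq (horner_alg x q) (horner_alg x p); first exact: map_f.
  case: e_min; exists (horner_alg x p), (horner_alg x q - horner_alg x p).
  rewrite !mulrBr !mulrBl ee pq qp idem // !subrr subr0 subr_eq0.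
  by split; rewrite ?neq0 // addrC subrK.
split; [exact: neq0 | exact: idem |].
case=> e1 [e2 [[e1_neq0 e2_neq0] e1e1 e2e2 [e12 _] pe]].
have [q1 qe1] := horner_alg_surj e1; have [q2 qe2] := horner_alg_surj e2.
rewrite -{}qe1 -{}qe2 in e1_neq0 e2_neq0 e1e1 e2e2 e12 pe.
have [t1 t1N q1t1] := idempotent_neq0_val e1_neq0 e1e1.
have [t2 t2N q2t2] := idempotent_neq0_val e2_neq0 e2e2.
have orth t : t ^+ N = emb a -> val q1 t * val q2 t = 0.
  move: e12; rewrite -rmorphM => /horner_alg_eq0 e12 tN.
  by rewrite -(e12 t tN) rmorphM hornerM.
have pE t : t ^+ N = emb a -> val p t = val q1 t + val q2 t.
  move: pe; rewrite -rmorphD => pe tN.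
  by rewrite (horner_alg_inj_on tN pe) rmorphD hornerD.
have q2t1 : val q2 t1 = 0 by rewrite -[LHS]mul1r -q1t1 orth.
have q1t2 : val q1 t2 = 0 by rewrite -[LHS]mulr1 -q2t2 orth.
have [_ _ p_conj] := ps_ind p p_ps.
have := p_conj t2 t1 t2N t1N _ _ q1 q1t2; rewrite !pE // q1t1 q2t1 q1t2 q2t2.
by rewrite add0r addr0 => /(_ erefl erefl)/eqP; rewrite oner_eq0.
Qed.

End PowerBasis.

(** * Lists of averaging formulas *)

Lemma geometric_average (F : fieldType) N (t : F) : N%:R != 0 :> F -> t ^+ N = 1 ->
  N%:R^-1 * \sum_(j < N) t ^+ j = (t == 1)%:R.
Proof.
move=> N0 tN; have [->|t1] := eqVneq t 1.
  by under eq_bigr do rewrite expr1n; rewrite sumr_const card_ord mulVf.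
apply/eqP; rewrite mulf_eq0; apply/orP; right.
by move/eqP: (subrX1 t N); rewrite tN subrr eq_sym mulf_eq0 subr_eq0 (negPf t1).
Qed.

Lemma sum_eq_uniq (R : nzSemiRingType) (T : eqType) (B : seq T) y : uniq B ->
  \sum_(b <- B) (y == b)%:R = (y \in B)%:R :> R.
Proof.
elim: B => [|b B IHB] /= => [_|/andP[bB /IHB IH]]; first by rewrite big_nil.
rewrite big_cons IH inE; case: eqVneq => [->|_]; last by rewrite add0r.
by rewrite (negPf bB) addr0.
Qed.

Section Realization.

Variables (K : fieldType) (Kbar : closedFieldType) (emb : {rmorphism K -> Kbar}).
Variables (A : falgType K) (x : A) (N : nat) (a : K) (zeta : Kbar).
Hypotheses (N_gt0 : (0 < N)%N) (a_neq0 : a != 0) (zeta_prim : N.-primitive_root zeta).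
Hypothesis x_basis : basis_of {:A}%VS [seq x ^+ j | j <- iota 0 N].
Hypothesis xN : x ^+ N = a%:A.

Notation val q t := (map_poly emb q).[t].

(** The number w t of indicated sets that contain the root t is recorded,
    instead of asking for a partition, because it is additive under
    concatenation of lists; the complete lists are those with w = 1. *)
Definition realizes (fs : seq (avg Kbar A)) (w : Kbar -> nat) : Prop :=
  exists ps : seq {poly K},
    [/\ List.Forall2 (@denotes K Kbar emb A) fs [seq horner_alg x p | p <- ps],
        forall p, p \in ps -> conjugacy_indicator emb N a p
      & forall t, t ^+ N = emb a -> count (fun p => val p t != 0) ps = w t].

Lemma realizes_ext fs w w' : realizes fs w ->
  (forall t, t ^+ N = emb a -> w t = w' t) -> realizes fs w'.
Proof.
case=> ps [ps_fs ps_ind ps_w] ww'; exists ps; split=> // t tN.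
by rewrite ps_w ?ww'.
Qed.

Lemma realizes_nil : realizes [::] (fun=> 0%N).
Proof. by exists [::]; split=> //; apply: List.Forall2_nil. Qed.

Lemma realizes_cat fs fs' w w' : realizes fs w -> realizes fs' w' ->
  realizes (fs ++ fs') (fun t => w t + w' t)%N.
Proof.
case=> ps [ps_fs ps_ind ps_w] [ps' [ps_fs' ps_ind' ps_w']]; exists (ps ++ ps'); split.
- by rewrite map_cat; apply: List.Forall2_app.
- by move=> p; rewrite mem_cat => /orP[/ps_ind | /ps_ind'].
- by move=> t tN; rewrite count_cat ps_w ?ps_w'.
Qed.

Lemma realizes_flatten (I : eqType) (r : seq I) F w :
  (forall i, i \in r -> realizes (F i) (w i)) ->
  realizes (flatten [seq F i | i <- r]) (fun t => \sum_(i <- r) w i t)%N.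
Proof.
elim: r => [_|i r IHr Fw] /=.
  by apply: realizes_ext realizes_nil _ => t _; rewrite big_nil.
have Fi := Fw i (mem_head _ _).
have Fr : realizes (flatten [seq F i | i <- r]) (fun t => \sum_(i <- r) w i t)%N.
  by apply: IHr => k kr; apply: Fw; rewrite inE kr orbT.
by apply: realizes_ext (realizes_cat Fi Fr) _ => t _; rewrite big_cons.
Qed.

Lemma realizes_map (I : eqType) (r : seq I) F w :
  (forall i, i \in r -> realizes [:: F i] (w i)) ->
  realizes [seq F i | i <- r] (fun t => \sum_(i <- r) w i t)%N.
Proof. by move/realizes_flatten; rewrite flatten_map1. Qed.

Lemma realizes_minimal fs : realizes fs (fun=> 1%N) -> minimal_idempotents_are emb fs.
Proof.
case=> ps [ps_fs ps_ind ps_w]; exists [seq horner_alg x p | p <- ps].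
by have [] := minimal_idempotents_of_indicators
  N_gt0 a_neq0 zeta_prim x_basis xN ps_ind ps_w.
Qed.

Lemma K_conjugate_scale c z z' :
  K_conjugate emb z z' -> K_conjugate emb (emb c * z) (emb c * z').
Proof.
move=> zz' q; have E y : val q (emb c * y) = val (q \Po (c *: 'X)) y.
  by rewrite map_comp_poly horner_comp /= map_polyZ map_polyX /= hornerZ hornerX.
by rewrite !E => /zz'.
Qed.

(** The formula whose coefficients are the sums of the b^-j over b in B averages
    to the indicator of the roots t with h t^(2^k) in B; these roots are
    conjugate by [root_K_conjugate]. *)
Lemma realizes_block k q h (B : seq Kbar) coef (S : Kbar -> Prop) i :
    (2 ^ k * 2 ^ q)%N = N -> h != 0 -> 2%:R != 0 :> Kbar ->
    subextension emb S -> S i -> i ^+ 2 = -1 ->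
    uniq B -> B != [::] ->
    (forall b, b \in B -> [/\ S b, b ^+ (2 ^ q) = emb (h ^+ (2 ^ q) * a)
       & (0 < k)%N -> forall v, S v -> v ^+ 2 <> b / emb h]) ->
    (forall b b', b \in B -> b' \in B -> K_conjugate emb b b') ->
    (forall j, in_base emb (\sum_(b <- B) b ^- j)) ->
    (forall j, (j < 2 ^ q)%N -> coef j = \sum_(b <- B) b ^- j) ->
  realizes [:: Avg (2 ^ q) coef (h *: x ^+ (2 ^ k))]
           (fun t => emb h * t ^+ (2 ^ k) \in B).
Proof.
move=> kqN h0 two_neq0 sS Si i2 uB nB HB B_conj B_base coefE.
have eh0 : emb h != 0 by rewrite fmorph_eq0.
have Bneq0 b : b \in B -> b != 0.
  case/HB=> _ bq _; apply: contra_neqN (mulf_neq0 (expf_neq0 (2 ^ q) h0) a_neq0) => /eqP b0.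
  by apply/eqP; rewrite -(fmorph_eq0 emb) -bq b0 expr0n expn_eq0.
have [c cE] : exists c : 'I_(2 ^ q) -> K, forall j, emb (c j) = coef j.
  apply: (@fin_all_exists 'I_(2 ^ q) (fun=> K) (fun j c => emb c = coef j)) => j.
  by have [c cE] := B_base j; exists c; rewrite coefE.
pose p := (2 ^ q)%:R^-1 *: \sum_(j < 2 ^ q) c j *: (h *: 'X^(2 ^ k)) ^+ j.
have q0 : (2 ^ q)%:R != 0 :> Kbar by rewrite natrX expf_neq0.
have pE t : t ^+ N = emb a -> val p t = (emb h * t ^+ (2 ^ k) \in B)%:R.
  move=> tN; rewrite -(sum_eq_uniq _ _ uB).
  rewrite /p map_polyZ /= hornerZ rmorph_sum horner_sum fmorphV rmorph_nat /=.
  under eq_bigr => j _.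
    rewrite map_polyZ hornerZ cE coefE // rmorphXn /= map_polyZ map_polyXn /=.
    rewrite horner_exp hornerZ hornerXn mulr_suml.
    over.
  rewrite exchange_big mulr_sumr /= [LHS]big_seq [RHS]big_seq.
  apply: eq_bigr => b bB; have b0 := Bneq0 b bB; have [_ bq _] := HB b bB.
  under eq_bigr do rewrite mulrC -exprVn -exprMn.
  rewrite geometric_average //.
    by rewrite -(inj_eq (mulIf b0)) mul1r divfK.
  rewrite exprMn exprVn bq exprMn rmorphM rmorphXn -exprM kqN tN divff //.
  by rewrite mulf_neq0 ?expf_neq0 // fmorph_eq0.
exists [:: p]; split.
- constructor; last exact: List.Forall2_nil.
  exists (fun j => if insub j is Some j' then c j' else 0); split=> /= [j jq|].
    by rewrite insubT cE.
  rewrite /p linearZ /= rmorph_sum mulr_algl; congr (_ *: _); apply: eq_bigr => j _.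
  rewrite valK [LHS]linearZ /= mulr_algl rmorphXn /=; congr (_ *: _ ^+ _).
  by rewrite linearZ /= mulr_algl rmorphXn /= horner_algX.
- move=> _ /[1!inE] /eqP->; split.
  + by move=> t /pE->; case: (_ \in B); [right | left].
  + case: B nB HB pE {uB B_conj B_base coefE Bneq0} => // b B _ HB pE.
    have [_ bq _] := HB b (mem_head _ _).
    have [t tk] := power_root_exists (b / emb h) (expn_gt0 2 k : (0 < 2 ^ k)%N).
    have tN : t ^+ N = emb a.
      rewrite -kqN exprM tk exprMn bq exprVn rmorphM rmorphXn mulrC mulKf //.
      by rewrite expf_neq0.
    by exists t => //; rewrite pE // tk mulrC divfK // mem_head.
  + move=> t t' tN t'N; rewrite !pE //.
    case: (boolP (_ \in B)) => [tB _|_ /esym/eqP]; last by rewrite oner_eq0.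
    case: (boolP (_ \in B)) => [t'B _|_ /esym/eqP]; last by rewrite oner_eq0.
    have [St _ nsq] := HB _ tB.
    have E z : z ^+ (2 ^ k) = emb h^-1 * (emb h * z ^+ (2 ^ k)).
      by rewrite fmorphV mulKf.
    have [Sc _ SM _] := sS.
    apply: (root_K_conjugate two_neq0 sS Si i2 (k := k)).
    * by rewrite E; apply: SM.
    * by move=> k0 v Sv; rewrite E fmorphV mulrC; apply: nsq.
    * by rewrite (E t) (E t'); apply: K_conjugate_scale; apply: B_conj.
- by move=> t tN /=; rewrite pE // addn0; case: (_ \in B); rewrite ?oner_eq0 ?eqxx.
Qed.

End Realization.

(** * Indicator sums over roots of unity *)

(** As numbers, [z = y] + [z = -y] = [z^2 = y^2]: the two cases exclude each
    other because y <> -y. *)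
Lemma eq_or_opp (F : fieldType) (z y : F) : 2%:R != 0 :> F -> y != 0 ->
  ((z == y) + (z == - y))%N = (z ^+ 2 == y ^+ 2).
Proof.
move=> two_neq0 y0; rewrite eqf_sqr; case: eqVneq => [->|] //=.
suff /negPf-> : y != - y by [].
by rewrite -subr_eq0 opprK -mulr2n -mulr_natl mulf_neq0.
Qed.

(** The powers r^i with i < Q are distinct and are all the roots of X^Q - 1. *)
Lemma sum_eq_geometric (F : fieldType) Q (r w A : F) : Q.-primitive_root r -> A != 0 ->
  (\sum_(i <- index_iota 0 Q) (w == (A * r ^+ i)%R))%N = (w ^+ Q == A ^+ Q).
Proof.
move=> r_prim A0; rewrite big_mkord.
have -> : (w ^+ Q == A ^+ Q) = ((w / A) ^+ Q == 1).
  by rewrite exprMn exprVn -[RHS](inj_eq (mulIf (expf_neq0 Q A0))) divfK ?expf_neq0 // mul1r.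
case: eqP => [/(prim_rootP r_prim)[i0 wE]|wQ].
  have -> : w = A * r ^+ i0 by rewrite -wE mulrCA divff // mulr1.
  rewrite (bigD1 i0) //= eqxx big1 // => i i_neq.
  apply/eqP; rewrite eqb0 (inj_eq (mulfI A0)) (eq_prim_root_expr r_prim).
  by rewrite !modn_small // eq_sym.
rewrite big1 // => i _; apply/eqP; rewrite eqb0; apply: contra_notN wQ => /eqP->.
by rewrite mulrC mulKf // -exprM mulnC exprM (prim_expr_order r_prim) expr1n.
Qed.

(** The cosets of A and C are told apart by their Q-th powers A^Q and - A^Q,
    so w is on at most one of them, and on one exactly when w^(2Q) = A^(2Q). *)
Lemma sum_eq_coset_pair (F : fieldType) Q (r w A C : F) : 2%:R != 0 :> F ->
    Q.-primitive_root r -> A != 0 -> C ^+ Q = - A ^+ Q ->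
  (\sum_(i <- index_iota 0 Q) ((w == (A * r ^+ i)%R) + (w == (C * r ^- i)%R)))%N
  = (w ^+ (Q * 2) == A ^+ (Q * 2)).
Proof.
move=> two_neq0 r_prim A0 CQ; have Q_gt0 := prim_order_gt0 r_prim.
have rV_prim : Q.-primitive_root r^-1.
  rewrite /primitive_root_of_unity Q_gt0 /=; apply/forallP=> j.
  by rewrite unity_rootE exprVn invr_eq1 -unity_rootE; have /andP[_ /forallP] := r_prim.
have C0 : C != 0.
  apply: contraTneq (expf_neq0 Q A0) => C0; move/eqP: CQ.
  by rewrite C0 expr0n eqn0Ngt Q_gt0 eq_sym oppr_eq0 => ->.
rewrite big_split /= sum_eq_geometric //.
under [X in (_ + X)%N]eq_bigr do rewrite -exprVn.
by rewrite sum_eq_geometric // CQ eq_or_opp ?expf_neq0 // !exprM.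
Qed.

(** The list 1, -1, r^1, r^-1, ..., r^(Q-1), r^-(Q-1) runs once through the
    2Q powers of r, since r^Q = -1 and r^-i = r^(2Q-i). *)
Lemma sum_eq_inverse_pair (F : fieldType) Q (r w : F) : (0 < Q)%N ->
    (Q * 2).-primitive_root r ->
  ((w == 1%R) + (w == (-1)%R)
   + \sum_(i <- index_iota 1 Q) ((w == (r ^+ i)%R) + (w == (r ^- i)%R)))%N
  = (w ^+ (Q * 2) == 1).
Proof.
move=> Q_gt0 r_prim.
have rQ : r ^+ Q = -1.
  have := prim_expr_order r_prim; rewrite exprM => /eqP.
  rewrite sqrf_eq1 => /orP[|/eqP//].
  rewrite -[1](expr0 r) (eq_prim_root_expr r_prim) mod0n modn_small; last first.
    by rewrite -{1}[Q]muln1 ltn_pmul2l.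
  by rewrite eqn0Ngt Q_gt0.
have := sum_eq_geometric w r_prim (oner_neq0 F); rewrite expr1n => <-.
under [RHS]eq_bigr do rewrite mul1r.
rewrite [RHS](big_cat_nat (n := Q)) //=; last by rewrite leq_pmulr.
rewrite (@big_ltn _ _ _ Q (Q * 2)) //; last by rewrite -{1}[Q]muln1 ltn_pmul2l.
rewrite (@big_ltn _ _ _ 0 Q) // expr0 rQ.
rewrite -!addnA; congr (_ + _)%N; rewrite big_split /=.
rewrite [RHS]addnCA; congr (_ + (_ + _))%N.
rewrite [RHS]big_nat_rev /= -[X in (_ = \big[_/_]_(X <= _ < _) _)%N]add1n big_addn.
have -> : ((Q * 2) - Q = Q)%N by rewrite muln2 -addnn addnK.
rewrite big_nat [RHS]big_nat; apply: eq_bigr => i /andP[_ iQ].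
have -> : (Q.+1 + Q * 2 - (i + Q).+1 = Q * 2 - i)%N.
  by rewrite addSn subSS (addnC i) subnDl.
have i2Q : (i < Q * 2)%N by rewrite (leq_trans iQ) ?leq_pmulr.
by rewrite expfB // (prim_expr_order r_prim) mul1r.
Qed.

(** Telescoping of [z = 1] + [z = -1] = [z^2 = 1] along z = u^(2^r M). *)
Lemma sum_expN1 (F : fieldType) (u : F) M r0 r1 : 2%:R != 0 :> F -> (r0 <= r1)%N ->
  ((u ^+ (2 ^ r0 * M) == 1%R)
   + \sum_(r0 <= r < r1) (u ^+ (2 ^ r * M) == (-1)%R))%N
  = (u ^+ (2 ^ r1 * M) == 1).
Proof.
move=> two_neq0; elim: r1 => [|r1 IHr]; first by rewrite leqn0 => /eqP->; rewrite big_geq ?addn0.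
rewrite leq_eqVlt => /orP[/eqP->|]; first by rewrite big_geq ?addn0.
rewrite ltnS => r01; rewrite big_nat_recr //= addnA IHr // eq_or_opp ?oner_neq0 //.
by rewrite expr1n -exprM expnSr mulnAC.
Qed.

(** * Roots of unity of order a power of two *)

Section TwoPowerRoots.

Variables (K : fieldType) (Kbar : closedFieldType) (emb : {rmorphism K -> Kbar}).
Variable eps : nat -> Kbar.
Hypothesis eps_compatible : compatible_roots eps.
Hypothesis two_neq0 : 2%:R != 0 :> Kbar.
Hypothesis i_notin : ~ in_base emb (eps 2).

Notation conj_pair := (conj_pair emb (eps 2)).
Notation L := (adjoin_sqrt (in_base emb) (eps 2)).

Lemma eps_prim k : (2 ^ k)%N.-primitive_root (eps k).
Proof. by case: (eps_compatible k). Qed.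

Lemma eps_sqr k : eps k.+1 ^+ 2 = eps k.
Proof. by case: (eps_compatible k). Qed.

Lemma eps_neq0 k : eps k != 0.
Proof.
apply: contraTneq (oner_neq0 Kbar) => e0.
by rewrite -(prim_expr_order (eps_prim k)) e0 expr0n expn_eq0 eqxx.
Qed.

Lemma epsX j k : eps (k + j) ^+ (2 ^ j) = eps k.
Proof.
elim: j => [|j IHj]; first by rewrite addn0 expr1.
by rewrite addnS expnS exprM eps_sqr.
Qed.

Lemma eps0 : eps 0 = 1.
Proof. exact: (prim_expr_order (eps_prim 0)). Qed.

Lemma eps1 : eps 1 = -1.
Proof.
have /eqP := eps_sqr 0; rewrite eps0 sqrf_eq1 => /orP[/eqP e1|/eqP//].
by have := prim_order_dvd (eps_prim 1) 1; rewrite expr1 e1 eqxx.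
Qed.

Lemma eps2_sqr : eps 2 ^+ 2 = -1.
Proof. by rewrite eps_sqr eps1. Qed.

Lemma epsX_i k : eps k.+2 ^+ (2 ^ k) = eps 2.
Proof. by rewrite -(epsX k 2) add2n. Qed.

Lemma epsX_N1 k : eps k.+1 ^+ (2 ^ k) = -1.
Proof. by rewrite -eps1 -(epsX k 1) add1n. Qed.

Lemma conj_pair_eps k :
  in_base emb (eps k + (eps k)^-1) -> conj_pair (eps k) (eps k)^-1.
Proof.
case: k => [|[|k]] eB.
- by rewrite eps0 invr1; apply: conj_pair1.
- by rewrite eps1 invrN invr1; apply: conj_pairN1.
apply: (conj_pair_quadratic i_notin (k := (2 ^ k)%N)) => //.
- by exists 1; rewrite divff ?rmorph1 // eps_neq0.
- exact: epsX_i.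
- rewrite exprVn epsX_i; apply: (mulfI (eps_neq0 2)).
  by rewrite divff ?eps_neq0 // mulrN -expr2 eps2_sqr opprK.
Qed.

(** eps j is a power of eps k. *)
Lemma conj_pair_eps_le j k : (j <= k)%N ->
  conj_pair (eps k) (eps k)^-1 -> conj_pair (eps j) (eps j)^-1.
Proof.
move=> /subnKC <- /(conj_pairX eps2_sqr (2 ^ (k - j))).
by rewrite exprVn epsX.
Qed.

(** The exponent 2^(m-2) that takes eps m to i is even for m >= 3, so the sign
    in - (eps m)^-1 disappears there and it is taken to i^-1 = - i. *)
Lemma typeE_conj m : typeE emb eps m -> conj_pair (eps m) (- (eps m)^-1).
Proof.
case: m => [|[|[|k]]] [] // _ eB.
apply: (conj_pair_quadratic i_notin (k := (2 ^ k.+1)%N)) => //.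
- by exists (-1); rewrite mulrN divff ?rmorphN1 // eps_neq0.
- exact: epsX_i.
- rewrite exprNn exprVn epsX_i expnS exprM sqrrN !expr1n mul1r.
  apply: (mulfI (eps_neq0 2)).
  by rewrite divff ?eps_neq0 // mulrN -expr2 eps2_sqr opprK.
Qed.

Lemma typeE_conj_pred m : typeE emb eps m ->
  conj_pair (eps (m - 1)) (eps (m - 1))^-1.
Proof.
move=> tE; have [m3 _] := tE; have := conj_pairX eps2_sqr 2 (typeE_conj tE).
by rewrite sqrrN exprVn -{1 2}(subnK (ltnW (ltnW m3))) addn1 eps_sqr.
Qed.

Lemma typeD_conj m : typeD emb eps m -> conj_pair (eps m) (eps m)^-1.
Proof. by case=> _ /conj_pair_eps. Qed.

Lemma typeDE_conj_pred m : typeD emb eps m \/ typeE emb eps m ->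
  conj_pair (eps (m - 1)) (eps (m - 1))^-1.
Proof.
case=> [/typeD_conj|/typeE_conj_pred] //.
by apply: conj_pair_eps_le; rewrite leq_subr.
Qed.

Lemma prim_root_of_expN1 k (w : Kbar) : w ^+ (2 ^ k) = -1 ->
  (2 ^ k.+1)%N.-primitive_root w.
Proof.
move=> wk; have w1 : w ^+ (2 ^ k.+1) = 1 by rewrite expnSr exprM wk sqrrN expr1n.
have [d d_prim /(dvdn_pfactor d k.+1 (isT : prime 2))[j jk dE]] :=
  prim_order_exists (expn_gt0 2 k.+1 : (0 < 2 ^ k.+1)%N) w1.
rewrite dE in d_prim; move: jk; rewrite leq_eqVlt => /orP[/eqP<- //|jk].
have : w ^+ (2 ^ k) = 1.
  by rewrite -(subnKC (jk : (j <= k)%N)) expnD exprM (prim_expr_order d_prim) expr1n.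
rewrite wk => /eqP; rewrite -subr_eq0 -opprD oppr_eq0 -mulr2n.
by rewrite (negPf two_neq0).
Qed.

(** The conjugate w' of eps (m+1) is a square root of the conjugate of eps m.
    In type D this gives w' = +- (eps (m+1))^-1, and the trace of eps (m+1) is
    one of the two elements that type D keeps out of K.  In type E it gives
    w' = +- i (eps (m+1))^-1, and conjugating twice sends eps (m+1) to its
    opposite. *)
Lemma typeDE_eps_succ m : typeD emb eps m \/ typeE emb eps m -> ~ L (eps m.+1).
Proof.
move=> mDE /conj_pairP[w' ew'].
have ew'2 := conj_pairX eps2_sqr 2 ew'; rewrite eps_sqr in ew'2.
have e0 := eps_neq0 m.+1.
case: mDE => [mD|mE].
  have := conj_pair_uniq i_notin ew'2 (typeD_conj mD).
  move/eqP; rewrite -eps_sqr -exprVn eqf_sqr => /orP[]/eqP w'E; move: ew'; rewrite w'E.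
    by move/conj_pair_trace; case: mD.
  by move/conj_pair_trace; case: mD.
have := conj_pair_uniq i_notin ew'2 (typeE_conj mE).
have -> : - (eps m)^-1 = (eps 2 * (eps m.+1)^-1) ^+ 2.
  by rewrite exprMn eps2_sqr exprVn eps_sqr mulN1r.
have i_conj := conj_pair_i emb (eps 2).
have eV := conj_pairV eps2_sqr i_notin ew'.
have ieV := conj_pairM eps2_sqr i_conj eV.
have w'e := conj_pair_sym ew'.
have two_e : eps m.+1 = - eps m.+1 -> False.
  move/eqP; rewrite -subr_eq0 opprK -mulr2n -mulr_natl mulf_eq0.
  by rewrite (negPf two_neq0) (negPf e0).
have i0 := eps_neq0 2.
have iV : (eps 2)^-1 = - eps 2.
  apply: (mulfI i0).
  by rewrite divff // mulrN -expr2 eps2_sqr opprK.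
move/eqP; rewrite eqf_sqr => /orP[]/eqP w'E.
  have := conj_pair_uniq i_notin w'e _; rewrite {1}w'E => /(_ _ ieV).
  by rewrite w'E invfM invrK mulrA iV mulrNN -expr2 eps2_sqr mulN1r => /two_e.
have ieVN : conj_pair (- (eps 2 * (eps m.+1)^-1)) (- (- eps 2 * w'^-1)).
  by rewrite -!(mulN1r (_ * _)); apply: conj_pairM ieV => //; [exact: eps2_sqr | exact: conj_pairN1].
have := conj_pair_uniq i_notin w'e _; rewrite {1}w'E => /(_ _ ieVN).
by rewrite w'E invrN invfM invrK mulrN opprK mulrA iV mulrNN -expr2 eps2_sqr mulN1r => /two_e.
Qed.

(** w is a primitive 2^m-th root of unity, so v would be one of order 2^(m+1)
    and eps (m+1) would be a power of it. *)
Lemma typeDE_nonsquare m w v : typeD emb eps m \/ typeE emb eps m ->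
  w ^+ (2 ^ (m - 1)) = -1 -> L v -> v ^+ 2 <> w.
Proof.
move=> mDE wN1 Lv v2; apply: (typeDE_eps_succ mDE).
have m0 : (0 < m)%N by case: mDE => -[/ltnW//]; case: m {wN1 v2}.
have v_prim : (2 ^ m.+1)%N.-primitive_root v.
  by apply: prim_root_of_expN1; rewrite -(subnK m0) addn1 expnS exprM v2.
have [j ->] := prim_rootP v_prim (prim_expr_order (eps_prim m.+1)).
have /conj_pairP[v' vv'] := Lv.
exact: conj_pair_adjoin (conj_pairX eps2_sqr j vv').
Qed.

End TwoPowerRoots.

(** * Power basis of a cyclic twisted group algebra *)

(** The power bar g^j is a nonzero multiple of bar (g^j) for j >= 1 only, as bar 1
    need not be the unit.  So the elements of the group are written g^j with
    1 <= j <= #|G|, and the last power is the unit up to the scalar a. *)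
Lemma twisted_power_basis (K : fieldType) (gT : finGroupType) (G : {group gT}) (g : gT)
    (A : falgType K) (bar : gT -> A) (a : K) :
    G :=: <[g]>%g -> is_twisted_group_algebra G bar -> a != 0 ->
    bar g ^+ #|G| = a%:A ->
  basis_of {:A}%VS [seq bar g ^+ j | j <- iota 0 #|G|].
Proof.
move=> defG [bar_basis [gamma gammaP]] a0 xN; set N := #|G| in xN *.
have N_gt0 : (0 < N)%N by apply: cardG_gt0.
have Gg j : (g ^+ j \in G)%g by rewrite defG mem_cycle.
have bar_power j : exists2 c : K, c != 0 & bar g ^+ j.+1 = c *: bar (g ^+ j.+1)%g.
  elim: j => [|j [c c0 IHj]]; first by exists 1; rewrite ?oner_neq0 // scale1r.
  have [gam0 gamE] := gammaP _ _ (Gg 1%N) (Gg j.+1); rewrite expg1 in gam0 gamE.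
  exists (c * gamma g (g ^+ j.+1)%g); first by rewrite mulf_neq0.
  by rewrite exprS IHj -scalerAr gamE scalerA -expgS.
rewrite basisEdim size_map size_iota; apply/andP; split; last first.
  by rewrite (size_basis (X := in_tuple _) bar_basis) size_map -cardE.
rewrite -(span_basis bar_basis); apply/span_subvP=> v /mapP[h]; rewrite mem_enum => hG -> {v}.
have [j jN hE] : exists2 j, (j < N)%N & (h = g ^+ j.+1)%g.
  have /cyclePmin[j jN hE] : (h * g^-1)%g \in <[g]>%g.
    by rewrite -defG groupM // groupV -(expg1 g).
  by exists j; [rewrite /N defG | rewrite expgSr -hE mulgKV].
have [c c0 cE] := bar_power j.
have -> : bar h = c^-1 *: bar g ^+ j.+1 by rewrite cE -hE scalerA mulVf // scale1r.
apply: memvZ.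
have mem_power l : (l < N)%N -> bar g ^+ l \in <<[seq (bar g ^+ j)%R | j <- iota 0 N]>>%VS.
  by move=> lN; apply/memv_span/mapP; exists l; rewrite // mem_iota.
have [jN1|] := ltnP j.+1 N; first exact: mem_power.
rewrite leq_eqVlt ltnNge jN orbF => /eqP <-; rewrite xN; apply: memvZ.
by rewrite -(expr0 (bar g)); apply: mem_power.
Qed.

(** * Formulas attached to conjugate pairs *)

Section Blocks.

Variables (K : fieldType) (Kbar : closedFieldType) (emb : {rmorphism K -> Kbar}).
Variable eps : nat -> Kbar.
Hypothesis eps_compatible : compatible_roots eps.
Hypothesis two_neq0 : 2%:R != 0 :> Kbar.
Hypothesis i_notin : ~ in_base emb (eps 2).
Variables (A : falgType K) (x : A) (n : nat) (a : K) (s : nat) (b : K).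
Hypotheses (a_neq0 : a != 0) (b_neq0 : b != 0).
Hypothesis s_le_n : (s <= n)%N.

Notation conj_pair := (conj_pair emb (eps 2)).
Notation L := (adjoin_sqrt (in_base emb) (eps 2)).
Hypothesis height_max : (s < n)%N -> forall v, L v -> v ^+ (2 ^ s.+1) <> emb a.

Notation realizes := (realizes emb x (2 ^ n) a).
Notation tau t := (t ^+ (2 ^ (n - s)) / emb b).
Notation base r := (b ^- (2 ^ r) *: x ^+ (2 ^ (n - s + r))).

Let eb0 : emb b != 0. Proof. by rewrite fmorph_eq0. Qed.
Let i2 := eps2_sqr eps_compatible.

(** The set B is {beta, beta'} listed without repetition, which covers at once
    the elements of K and those outside.  At level r = 0 no nonsquare condition
    is assumed: if b beta were the square of some v in L, then
    a = (b beta)^(2^s) = v^(2^(s+1)) would contradict [height_max].  For r > 0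
    the factor b^(2^r) is itself a square. *)
Lemma realizes_conjugates r (B : seq Kbar) (beta beta' : Kbar) coef :
    (r <= s)%N -> conj_pair beta beta' -> uniq B -> B =i [:: beta; beta'] ->
    beta ^+ (2 ^ (s - r)) * emb b ^+ (2 ^ s) = emb a ->
    ((0 < r)%N -> forall v, L v -> v ^+ 2 <> beta) ->
    (forall j, in_base emb (\sum_(z <- B) z ^- j)) ->
    (forall j, coef j = \sum_(z <- B) z ^- j) ->
  realizes [:: Avg (2 ^ (s - r)) coef (base r)]
           (fun t => \sum_(z <- B) (tau t ^+ (2 ^ r) == z))%N.
Proof.
move=> rs bb' uB BE betaX nsq B_base coefE.
have LS := base_adjoin_i_subextension i2 i_notin; have [_ _ LM LV] := LS.
have Lb c : L (emb c) by apply: (conj_pair_adjoin (conj_pair_base emb (eps 2) c)).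
have beta'X : beta' ^+ (2 ^ (s - r)) * emb b ^+ (2 ^ s) = emb a.
  apply: (conj_pair_uniq i_notin (z := emb a)); last exact: conj_pair_base.
  rewrite -{1}betaX; apply: (conj_pairM i2); first exact: (conj_pairX i2).
  by rewrite -rmorphXn; apply: conj_pair_base.
have key z : z \in B -> exists2 z', conj_pair z z' & z ^+ (2 ^ (s - r)) * emb b ^+ (2 ^ s) = emb a.
  rewrite BE !inE => /orP[]/eqP->; first by exists beta'.
  by exists beta => //; apply: conj_pair_sym.
have nsq' z : z \in B -> (0 < r)%N -> forall v, L v -> v ^+ 2 <> z.
  move=> zB r0 v Lv; move: zB; rewrite BE !inE => /orP[]/eqP-> v2; first exact: nsq v2.
  have /conj_pairP[v' vv'] := Lv.
  apply: (nsq r0 v' (conj_pair_adjoin (conj_pair_sym vv'))).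
  apply: (conj_pair_uniq i_notin (z := beta')); last exact: conj_pair_sym.
  by rewrite -v2; apply: (conj_pairX i2).
have R : realizes [:: Avg (2 ^ (s - r)) coef (base r)]
   (fun t => emb (b ^- (2 ^ r)) * t ^+ (2 ^ (n - s + r)) \in B).
  apply: (realizes_block x a_neq0 (S := L) (i := eps 2)) => //.
  - by rewrite -expnD -addnA subnKC // subnK.
  - by rewrite invr_neq0 ?expf_neq0.
  - exact: conj_pair_adjoin (conj_pair_i _ _).
  - by apply/eqP=> B0; have := BE beta; rewrite B0 !inE eqxx.
  - move=> z zB; have [z' zz' zX] := key z zB; split.
    + exact: conj_pair_adjoin zz'.
    + rewrite exprVn -exprM -expnD subnKC // rmorphM fmorphV rmorphXn -zX.
      by rewrite mulrC mulfK // expf_neq0.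
    + move=> k0 v Lv; rewrite fmorphV invrK rmorphXn.
      case: (posnP r) => [r0|r0 v2].
        rewrite r0 addn0 in k0 zX *; rewrite expr1 => v2.
        rewrite subn_gt0 in k0; apply: (height_max k0 Lv).
        by rewrite expnS exprM v2 exprMn -[s in z ^+ (2 ^ s)]subn0 zX.
      have bX0 : emb b ^+ (2 ^ r.-1) != 0 by rewrite expf_neq0.
      apply: (nsq' z zB r0 (v * (emb (b ^+ (2 ^ r.-1)))^-1)).
        by apply: LM => //; apply: LV.
      rewrite exprMn v2 exprVn rmorphXn -exprM -expnSr prednK //.
      by rewrite mulfK // expf_neq0.
  - move=> z z'; rewrite !BE !inE => /orP[]/eqP-> /orP[]/eqP->.
    + by move=> q.
    + exact: (conj_pair_K_conjugate i2 i_notin).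
    + exact: (conj_pair_K_conjugate i2 i_notin (conj_pair_sym bb')).
    + by move=> q.
apply: realizes_ext R _ => t _.
have -> : emb (b ^- (2 ^ r)) * t ^+ (2 ^ (n - s + r)) = tau t ^+ (2 ^ r).
  by rewrite exprMn -exprM -expnD mulrC fmorphV rmorphXn exprVn.
elim: (B) uB => [|z B' IHB] /=; first by rewrite big_nil.
case/andP=> zB' /IHB; rewrite inE big_cons => <-.
by case: eqVneq => // ->; rewrite (negPf zB').
Qed.

Lemma realizes_pair r (beta beta' : Kbar) coef :
    (r <= s)%N -> conj_pair beta beta' -> beta != beta' ->
    beta ^+ (2 ^ (s - r)) * emb b ^+ (2 ^ s) = emb a ->
    ((0 < r)%N -> forall v, L v -> v ^+ 2 <> beta) ->
    (forall j, coef j = beta ^- j + beta' ^- j) ->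
  realizes [:: Avg (2 ^ (s - r)) coef (base r)]
           (fun t => (tau t ^+ (2 ^ r) == beta) + (tau t ^+ (2 ^ r) == beta'))%N.
Proof.
move=> rs bb' neq betaX nsq coefE.
have R : realizes [:: Avg (2 ^ (s - r)) coef (base r)]
     (fun t => \sum_(z <- [:: beta; beta']) (tau t ^+ (2 ^ r) == z))%N.
  apply: (realizes_conjugates rs bb') => //.
  - by rewrite /= inE neq.
  - move=> j; rewrite !big_cons big_nil addr0; apply: (conj_pair_trace (i := eps 2)).
    by apply: (conj_pairV i2 i_notin); apply: (conj_pairX i2).
  - by move=> j; rewrite !big_cons big_nil addr0.
by apply: realizes_ext R _ => t _; rewrite !big_cons big_nil addn0.
Qed.

Lemma realizes_single r (c : K) coef :
    (r <= s)%N -> emb c ^+ (2 ^ (s - r)) * emb b ^+ (2 ^ s) = emb a ->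
    ((0 < r)%N -> forall v, L v -> v ^+ 2 <> emb c) ->
    (forall j, coef j = emb c ^- j) ->
  realizes [:: Avg (2 ^ (s - r)) coef (base r)]
           (fun t => tau t ^+ (2 ^ r) == emb c).
Proof.
move=> rs betaX nsq coefE.
have R : realizes [:: Avg (2 ^ (s - r)) coef (base r)]
     (fun t => \sum_(z <- [:: emb c]) (tau t ^+ (2 ^ r) == z))%N.
  apply: (realizes_conjugates rs (conj_pair_base emb (eps 2) c)) => //.
  - by move=> z; rewrite !inE orbb.
  - by move=> j; rewrite big_seq1; exists (c ^- j); rewrite fmorphV rmorphXn.
  - by move=> j; rewrite big_seq1.
by apply: realizes_ext R _ => t _; rewrite big_seq1.
Qed.

Lemma tau_order t : t ^+ (2 ^ n) = emb a ->
  tau t ^+ (2 ^ s) * emb b ^+ (2 ^ s) = emb a.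
Proof. by move=> tN; rewrite -exprMn divfK // -exprM -expnD subnK. Qed.

(** The values alpha rho^i have the conjugates alpha' rho^-i, and the condition
    on the Q-th powers keeps all 2Q of them apart. *)
Lemma realizes_coset_pairs r Q (rho alpha alpha' : Kbar) coef :
    (r <= s)%N -> Q.-primitive_root rho -> conj_pair rho rho^-1 ->
    rho ^+ (2 ^ (s - r)) = 1 ->
    conj_pair alpha alpha' -> alpha' ^+ Q = - alpha ^+ Q ->
    alpha ^+ (2 ^ (s - r)) * emb b ^+ (2 ^ s) = emb a ->
    ((0 < r)%N -> forall j v, L v -> v ^+ 2 <> alpha * rho ^+ j) ->
    (forall i j, coef i j = (alpha * rho ^+ i) ^- j + (alpha' * rho ^- i) ^- j) ->
  realizes [seq Avg (2 ^ (s - r)) (coef i) (base r) | i <- index_iota 0 Q]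
           (fun t => (tau t ^+ (2 ^ r)) ^+ (Q * 2) == alpha ^+ (Q * 2)).
Proof.
move=> rs rho_prim rho_conj rhoX alpha_conj alphaQ alphaX nsq coefE.
have alpha0 : alpha != 0.
  apply: contra_neq a_neq0 => alpha0; apply/eqP; rewrite -(fmorph_eq0 emb) -alphaX alpha0.
  by rewrite expr0n expn_eq0 mul0r.
have R : realizes [seq Avg (2 ^ (s - r)) (coef i) (base r) | i <- index_iota 0 Q]
  (fun t => \sum_(i <- index_iota 0 Q)
     ((tau t ^+ (2 ^ r) == (alpha * rho ^+ i)%R) + (tau t ^+ (2 ^ r) == (alpha' * rho ^- i)%R)))%N.
  apply: realizes_map => i _; apply: realizes_pair => //.
  - rewrite -exprVn; apply: (conj_pairM i2) => //; exact: (conj_pairX i2).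
  - apply: contraTneq (expf_neq0 Q alpha0) => /(congr1 (fun z => z ^+ Q)).
    rewrite !exprMn exprVn alphaQ -exprM mulnC exprM (prim_expr_order rho_prim) expr1n.
    rewrite invr1 !mulr1 => /eqP; rewrite -subr_eq0 opprK -mulr2n -mulr_natl mulf_eq0.
    by rewrite (negPf two_neq0) /= => ->.
  - by rewrite exprMn -[(_ ^+ i) ^+ _]exprM mulnC exprM rhoX expr1n mulr1.
  - by move=> r0; apply: nsq.
by apply: realizes_ext R _ => t _; apply: sum_eq_coset_pair.
Qed.

(** The roots covered are those with tau^(2^r) in d times the group of order
    2^(q+1).  The values d and - d are in K and give one idempotent each; the
    others are paired with their conjugates. *)
Lemma realizes_inverse_pairs r q (d : K) f1 f2 coef :
    (r <= s)%N -> (q < s - r)%N -> conj_pair (eps q.+1) (eps q.+1)^-1 ->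
    emb d ^+ (2 ^ (s - r)) * emb b ^+ (2 ^ s) = emb a ->
    ((0 < r)%N -> forall w v, w ^+ (2 ^ q.+1) = 1 -> L v -> v ^+ 2 <> emb d * w) ->
    (forall j, f1 j = emb d ^- j) -> (forall j, f2 j = (- emb d) ^- j) ->
    (forall i j, coef i j = (emb d * eps q.+1 ^+ i) ^- j + (emb d * eps q.+1 ^- i) ^- j) ->
  realizes ([:: Avg (2 ^ (s - r)) f1 (base r); Avg (2 ^ (s - r)) f2 (base r)] ++
            [seq Avg (2 ^ (s - r)) (coef i) (base r) | i <- index_iota 1 (2 ^ q)])
           (fun t => (tau t ^+ (2 ^ r)) ^+ (2 ^ q.+1) == emb d ^+ (2 ^ q.+1)).
Proof.
move=> rs qs eps_conj dX nsq f1E f2E coefE.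
have d0 : emb d != 0.
  apply: contra_neq a_neq0 => d0; apply/eqP; rewrite -(fmorph_eq0 emb) -dX d0.
  by rewrite expr0n expn_eq0 mul0r.
have even_N : exists k, (2 ^ (s - r) = 2 ^ q.+1 * k)%N.
  by exists (2 ^ (s - r - q.+1))%N; rewrite -expnD subnKC.
have [k kE] := even_N.
have epsN : eps q.+1 ^+ (2 ^ (s - r)) = 1.
  by rewrite kE exprM (prim_expr_order (eps_prim eps_compatible q.+1)) expr1n.
have R1 : realizes [:: Avg (2 ^ (s - r)) f1 (base r)]
  (fun t => tau t ^+ (2 ^ r) == emb d).
  apply: realizes_single => // r0 v Lv; rewrite -[emb d]mulr1.
  by apply: nsq => //; rewrite expr1n.
have R2 : realizes [:: Avg (2 ^ (s - r)) f2 (base r)]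
  (fun t => tau t ^+ (2 ^ r) == emb (- d)).
  apply: realizes_single => //.
  - by rewrite rmorphN kE expnS -mulnA exprM sqrrN -exprM mulnA -expnS -kE.
  - move=> r0 v Lv; rewrite rmorphN -mulrN1; apply: nsq => //.
    by rewrite expnS exprM sqrrN !expr1n.
  - by move=> j; rewrite rmorphN.
have R3 : realizes [seq Avg (2 ^ (s - r)) (coef i) (base r) | i <- index_iota 1 (2 ^ q)]
  (fun t => \sum_(i <- index_iota 1 (2 ^ q))
     ((tau t ^+ (2 ^ r) == (emb d * eps q.+1 ^+ i)%R)
      + (tau t ^+ (2 ^ r) == (emb d * eps q.+1 ^- i)%R)))%N.
  apply: realizes_map => i; rewrite mem_index_iota => /andP[i0 iq]; apply: realizes_pair => //.
  - apply: (conj_pairM i2); first exact: conj_pair_base.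
    by rewrite -exprVn; apply: (conj_pairX i2).
  - rewrite (inj_eq (mulfI d0)) -(inj_eq (mulfI (expf_neq0 i (eps_neq0 eps_compatible q.+1)))).
    rewrite divff ?expf_neq0 ?eps_neq0 // -exprD -[X in _ != X](expr0 (eps q.+1)).
    rewrite (eq_prim_root_expr (eps_prim eps_compatible q.+1)) mod0n modn_small.
      by rewrite addn_eq0 andbb -lt0n.
    by rewrite expnS mul2n -addnn -addSn leq_add // ltnW.
  - by rewrite exprMn -[(_ ^+ i) ^+ _]exprM mulnC exprM epsN expr1n mulr1.
  - move=> r0 v; apply: nsq => //.
    by rewrite -exprM mulnC exprM (prim_expr_order (eps_prim eps_compatible q.+1)) expr1n.
apply: realizes_ext (realizes_cat R1 (realizes_cat R2 R3)) _ => t _.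
set w := tau t ^+ _.
have wd (z : Kbar) : (w == emb d * z) = (w / emb d == z).
  by rewrite -[in RHS](inj_eq (mulIf d0)) divfK // mulrC.
have -> : (w ^+ (2 ^ q.+1) == emb d ^+ (2 ^ q.+1)) = ((w / emb d) ^+ (2 ^ q * 2) == 1).
  rewrite -expnSr exprMn exprVn -[RHS](inj_eq (mulIf (expf_neq0 (2 ^ q.+1) d0))).
  by rewrite divfK ?expf_neq0 // mul1r.
have eps_prim2 : (2 ^ q * 2).-primitive_root (eps q.+1).
  by rewrite -expnSr; apply: eps_prim.
rewrite -(sum_eq_inverse_pair (w / emb d) (expn_gt0 2 q : (0 < 2 ^ q)%N) eps_prim2) -addnA.
congr (_ + (_ + _))%N.
- by rewrite -wd mulr1.
- by rewrite -wd rmorphN mulrN1.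
- by apply: eq_bigr => i _; rewrite !wd.
Qed.

(** * The complete lists *)

(** Both sides are the conjugate of i = (eps (k+2))^(2^k). *)
Lemma eps_conj_pow k (z : Kbar) : conj_pair (eps k.+2) z ->
  z ^+ (2 ^ k) = - eps k.+2 ^+ (2 ^ k).
Proof.
move/(conj_pairX i2 (2 ^ k)); rewrite !(epsX_i eps_compatible) => iz.
by apply: (conj_pair_uniq i_notin iz); apply: conj_pair_i.
Qed.

Lemma realizes_allpairs (rs is_ : seq nat) F w :
  (forall r, r \in rs -> realizes [seq F r i | i <- is_] (w r)) ->
  realizes [seq F r i | r <- rs, i <- is_] (fun t => \sum_(r <- rs) w r t)%N.
Proof. exact: realizes_flatten. Qed.

Let div_tau (c : Kbar) : c != 0 ->
  c ^+ (2 ^ s) * emb b ^+ (2 ^ s) = emb a ->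
  forall t, t ^+ (2 ^ n) = emb a -> (tau t / c) ^+ (2 ^ s) = 1.
Proof.
move=> c0 cE t /tau_order; rewrite -cE => /(mulIf (expf_neq0 _ eb0)) tE.
by rewrite exprMn tE exprVn divff // expf_neq0.
Qed.

(** All 2^s-th roots of unity are in L, so every value of tau is, and level
    r = 0 is enough. *)
Lemma realizes_power_split : (0 < s)%N -> conj_pair (eps s) (eps s)^-1 -> a = b ^+ (2 ^ s) ->
  let y := b^-1 *: x ^+ (2 ^ (n - s)) in
  realizes (
        [:: Avg (2 ^ s)%N (fun j => 1) y;
            Avg (2 ^ s)%N (fun j => (-1) ^+ j) y] ++
        [seq Avg (2 ^ s)%N
               (fun j => eps s ^+ (i * j) + eps s ^- (i * j)) y
          | i <- index_iota 1 (2 ^ (s - 1))]) (fun=> 1%N).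
Proof.
move=> s0 eps_conj aE.
have aE' : 1 ^+ (2 ^ s) * emb b ^+ (2 ^ s) = emb a by rewrite expr1n mul1r aE rmorphXn.
have := @realizes_inverse_pairs 0 (s - 1) 1 (fun=> 1) (fun j => (-1) ^+ j)
  (fun i j => eps s ^+ (i * j) + eps s ^- (i * j)).
rewrite !subn0 !addn0 expn0 expr1 subn1 prednK // rmorph1 => H y.
apply: realizes_ext (H _ _ _ _ _ _ _ _) _ => // {H}.
- by move=> j; rewrite expr1n invr1.
- by move=> j; rewrite -exprVn invrN invr1.
- move=> i j; rewrite !mul1r addrC -[eps s ^- i]exprVn -!exprM -!exprVn.
  by rewrite !invrK exprVn.
move=> t tN; have := div_tau (oner_neq0 _) aE' tN; rewrite divr1 => tE.
by rewrite expr1 expr1n tE eqxx.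
Qed.

(** Here tau is a primitive 2^(s+1)-th root of unity in L.  These are the two
    cosets of the group of order 2^(s-1) through eps (s+1) and its conjugate. *)
Lemma realizes_opp_power (lambda : Kbar) : (0 < s)%N ->
    conj_pair (eps s.+1) (lambda * (eps s.+1)^-1) ->
    conj_pair (eps (s - 1)%N) (eps (s - 1)%N)^-1 -> a = - b ^+ (2 ^ s) ->
  let y := b^-1 *: x ^+ (2 ^ (n - s)) in
  realizes [seq Avg (2 ^ s)%N
               (fun j => eps s.+1 ^- j * eps (s - 1)%N ^- (i * j)
                         + lambda ^- j * eps s.+1 ^+ j * eps (s - 1)%N ^+ (i * j))
               y
          | i <- index_iota 0 (2 ^ (s - 1))] (fun=> 1%N).
Proof.
move=> s0 eps_conj rho_conj aE.
have := @realizes_coset_pairs 0 (2 ^ (s - 1)) (eps (s - 1)) (eps s.+1)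
  (lambda * (eps s.+1)^-1) (fun i j => eps s.+1 ^- j * eps (s - 1)%N ^- (i * j)
                         + lambda ^- j * eps s.+1 ^+ j * eps (s - 1)%N ^+ (i * j)).
have sE : (s = (s - 1).+1)%N by rewrite subn1 prednK.
have eN : eps s.+1 ^+ (2 ^ s) = -1 by apply: epsX_N1.
have aE' : eps s.+1 ^+ (2 ^ s) * emb b ^+ (2 ^ s) = emb a.
  by rewrite eN aE rmorphN rmorphXn mulN1r.
rewrite !subn0 !addn0 expn0 expr1 -expnSr -sE => H y.
apply: realizes_ext (H _ _ _ _ _ _ _ _ _) _ => // {H}.
- exact: eps_prim.
- by rewrite {2}sE expnSr exprM (prim_expr_order (eps_prim eps_compatible _)) expr1n.
- by have := @eps_conj_pow (s - 1) (lambda * (eps s.+1)^-1); rewrite -sE; apply.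
- by move=> i j; rewrite !exprMn !exprVn !invfM !invrK -!exprM.
move=> t tN; rewrite expr1 eN.
by move: (tau_order tN); rewrite -aE' eN => /(mulIf (expf_neq0 _ eb0))->; rewrite eqxx.
Qed.

(** With m = k + 2.  The values of tau in the group of order 2^(m-1) are paired
    at level 0.  For the others, tau^(2^r) is a primitive 2^m-th root of unity
    for exactly one r between 0 and s - m; the exponent 2^r is needed because L
    contains no root of unity of order 2^(m+1). *)
Lemma realizes_power_nonsplit k (lambda : Kbar) : typeD emb eps k.+2 \/ typeE emb eps k.+2 ->
    conj_pair (eps k.+2) (lambda * (eps k.+2)^-1) -> (k.+2 <= s)%N ->
    a = b ^+ (2 ^ s) ->
  let y := b^-1 *: x ^+ (2 ^ (n - s)) in
  realizes (
        [:: Avg (2 ^ s)%N (fun j => 1) y;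
            Avg (2 ^ s)%N (fun j => (-1) ^+ j) y] ++
        [seq Avg (2 ^ s)%N
               (fun j => eps k.+1 ^+ (i * j) + eps k.+1 ^- (i * j)) y
          | i <- index_iota 1 (2 ^ k)] ++
        [seq Avg (2 ^ (s - r))%N
               (fun j => eps k.+2 ^- j * eps k ^- (i * j)
                         + lambda ^- j * eps k.+2 ^+ j * eps k ^+ (i * j))
               (b ^- (2 ^ r) *: x ^+ (2 ^ (n - s + r)))
          | r <- index_iota 0 (s - k.+2).+1, i <- index_iota 0 (2 ^ k)]) (fun=> 1%N).
Proof.
move=> mDE eps_conj ks aE.
have aE' : 1 ^+ (2 ^ s) * emb b ^+ (2 ^ s) = emb a by rewrite expr1n mul1r aE rmorphXn.
have pred_conj := typeDE_conj_pred eps_compatible i_notin mDE.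
rewrite subn1 /= in pred_conj.
have k_conj := conj_pair_eps_le eps_compatible (leqnSn k) pred_conj.
have R1 := @realizes_inverse_pairs 0 k 1 (fun=> 1) (fun j => (-1) ^+ j)
  (fun i j => eps k.+1 ^+ (i * j) + eps k.+1 ^- (i * j)).
rewrite !subn0 !addn0 expn0 expr1 rmorph1 in R1 * => y.
have {}R1 := R1 (leq0n _) (ltnW ks) pred_conj aE' _ _ _ _.
have R2 : realizes [seq Avg (2 ^ (s - r))%N
               (fun j => eps k.+2 ^- j * eps k ^- (i * j)
                         + lambda ^- j * eps k.+2 ^+ j * eps k ^+ (i * j))
               (b ^- (2 ^ r) *: x ^+ (2 ^ (n - s + r)))
          | r <- index_iota 0 (s - k.+2).+1, i <- index_iota 0 (2 ^ k)]
   (fun t => \sum_(r <- index_iota 0 (s - k.+2).+1)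
               ((tau t ^+ (2 ^ r)) ^+ (2 ^ k * 2) == eps k.+2 ^+ (2 ^ k * 2)))%N.
  apply: realizes_allpairs => r; rewrite mem_index_iota ltnS => /andP[_ rs].
  have r_le : (r <= s)%N by rewrite (leq_trans rs) ?leq_subr.
  have srk : (k.+2 <= s - r)%N by rewrite leq_subCr.
  have epsN j : (j <= k.+2)%N -> eps j ^+ (2 ^ (s - r)) = 1.
    move=> jk; rewrite -(subnKC (leq_trans jk srk)) expnD exprM.
    by rewrite (prim_expr_order (eps_prim eps_compatible j)) expr1n.
  apply: (realizes_coset_pairs (alpha' := lambda * (eps k.+2)^-1)) => //.
  - exact: eps_prim.
  - exact: k_conj.
  - by apply: epsN; rewrite ltnW.
  - exact: eps_conj_pow.
  - by rewrite epsN // mul1r aE rmorphXn.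
  - move=> r0 j v; apply: (typeDE_nonsquare eps_compatible two_neq0 i_notin mDE).
    rewrite subn1 /= exprMn (epsX_N1 eps_compatible) -exprM mulnC exprM expnSr exprM.
    by rewrite (prim_expr_order (eps_prim eps_compatible k)) !expr1n mulr1.
  - by move=> i j; rewrite !exprMn !exprVn !invfM !invrK -!exprM.
rewrite catA; apply: realizes_ext (realizes_cat (R1 _ _ _ _) R2) _ => //.
- by move=> j; rewrite expr1n invr1.
- by move=> j; rewrite -exprVn invrN invr1.
- move=> i j; rewrite !mul1r addrC -[eps k.+1 ^- i]exprVn -!exprM -!exprVn.
  by rewrite !invrK exprVn.
move=> t tN; have := div_tau (oner_neq0 _) aE' tN; rewrite divr1 => tE.
transitivity ((tau t ^+ (2 ^ 0 * 2 ^ k.+1) == 1%R)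
   + \sum_(0 <= r < (s - k.+2).+1) (tau t ^+ (2 ^ r * 2 ^ k.+1) == (-1)%R))%N.
  congr (_ + _)%N; first by rewrite expr1 expr1n mul1n.
  by apply: eq_bigr => r _; rewrite -expnSr -exprM (epsX_N1 eps_compatible).
by rewrite (sum_expN1 (tau t) (2 ^ k.+1) two_neq0 (leq0n _)) -expnD addSnnS subnK // tE eqxx.
Qed.

Lemma adjoin_nonsquare_scale (c w : Kbar) : L c -> c != 0 ->
  (forall v, L v -> v ^+ 2 <> w) -> forall v, L v -> v ^+ 2 <> c ^+ 2 * w.
Proof.
move=> Lc c0 nsq v Lv v2.
have [_ _ LM LV] := base_adjoin_i_subextension i2 i_notin.
apply: (nsq (v * c^-1)); first by apply: (LM) => //; apply: LV.
by rewrite exprMn v2 exprVn mulrAC divff ?mul1r // expf_neq0.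
Qed.

(** With m = k + 2, e = eps m and u = tau / (1 + e), a 2^s-th root of unity.
    The conjugate of 1 + e is (1 + e) / e, so conjugation maps the value
    tau = (1 + e) w, with w of order dividing 2^m, to (1 + e) e^-1 w^-1; these
    pairs form level 0.  If u^(2^m) = -1, then tau^2 = d w with d = (1 + e)^2 / e
    in K and w^(2^(m-1)) = 1, because d^(2^(m-1)) = - (1 + e)^(2^m): level 1.
    From level 2 on, u^(2^r) is a primitive 2^m-th root of unity, and the
    conjugate of (1 + e)^(2^r) picks up e^-(2^r), a power of eps (m-2). *)
Lemma realizes_shifted_power k : typeD emb eps k.+2 -> (k.+2 <= s)%N ->
    emb a = emb b ^+ (2 ^ s) * (1 + eps k.+2) ^+ (2 ^ s) ->
  let y := b^-1 *: x ^+ (2 ^ (n - s)) in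
  let y1 := b ^- 2 *: x ^+ (2 ^ (n - s + 1)) in
  let d := 2%:R + eps k.+2 + (eps k.+2)^-1 in
  realizes (
        [seq Avg (2 ^ s)%N
               (fun j => (1 + eps k.+2) ^- j *
                         (eps k.+1 ^- (i * j)
                          + eps k.+2 ^+ j * eps k.+1 ^+ (i * j))) y
          | i <- index_iota 0 (2 ^ k.+1)] ++
        (if (k.+2 + 1 <= s)%N then
          [:: Avg (2 ^ (s - 1))%N (fun j => d ^- j) y1;
              Avg (2 ^ (s - 1))%N (fun j => (-1) ^+ j * d ^- j) y1]
         else [::]) ++
        (if (k.+2 + 1 <= s)%N && (3 <= k.+2)%N then
          [seq Avg (2 ^ (s - 1))%N
                 (fun j => d ^- j * (eps k.+1 ^- (j * (1 + i))
                                     + eps k.+1 ^+ (j * (1 + i)))) y1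
            | i <- index_iota 0 (2 ^ k - 1)]
         else [::]) ++
        (if (k.+2 + 2 <= s)%N then
          [seq Avg (2 ^ (s - r))%N
                 (fun j => (1 + eps k.+2) ^- (j * 2 ^ r) *
                           (eps k.+2 ^- j * eps k ^- (i * j)
                            + eps k.+2 ^+ j * eps k ^+ (j * (i + 2 ^ (r - 2)))))
                 (b ^- (2 ^ r) *: x ^+ (2 ^ (n - s + r)))
            | r <- index_iota 2 (s - k.+2).+1, i <- index_iota 0 (2 ^ k)]
         else [::])) (fun=> 1%N).
Proof.
move=> mD ks aE y y1 d; set e := eps k.+2 in aE d *.
have mDE : typeD emb eps k.+2 \/ typeE emb eps k.+2 by left.
have e_conj : conj_pair e e^-1 := typeD_conj eps_compatible i_notin mD.
have k1_conj := conj_pair_eps_le eps_compatible (leqnSn k.+1) e_conj.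
have k_conj := conj_pair_eps_le eps_compatible (leqnSn k) k1_conj.
have e0 : e != 0 by apply: eps_neq0.
have e10 : 1 + e != 0.
  apply: contra_neq a_neq0 => e1; apply/eqP; rewrite -(fmorph_eq0 emb) aE e1.
  by rewrite expr0n expn_eq0 mulr0.
have e1_conj : conj_pair (1 + e) ((1 + e) * e^-1).
  have -> : (1 + e) * e^-1 = 1 + e^-1 by rewrite mulrDl mul1r divff // addrC.
  exact: conj_pairD (conj_pair1 _ _) e_conj.
have dE : d = (1 + e) ^+ 2 * e^-1 by rewrite /d; field.
have [_ [c cE] _ _] := mD; rewrite -/e in cE.
have dK : d = emb (2%:R + c) by rewrite rmorphD rmorph_nat -cE addrA.
have eps_one j l : (j <= l)%N -> eps j ^+ (2 ^ l) = 1.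
  move=> jl; rewrite -(subnKC jl) expnD exprM.
  by rewrite (prim_expr_order (eps_prim eps_compatible j)) expr1n.
have eM : e ^+ (2 ^ k.+1) = -1 by apply: epsX_N1.
have aE' : (1 + e) ^+ (2 ^ s) * emb b ^+ (2 ^ s) = emb a by rewrite aE mulrC.
have nsq w v : w ^+ (2 ^ k.+1) = -1 -> L v -> v ^+ 2 <> w.
  by move=> wN1; apply: (typeDE_nonsquare eps_compatible two_neq0 i_notin mDE); rewrite subn1.
pose u t := tau t / (1 + e).
have uE t (N : nat) c1 : (tau t ^+ N == (1 + e) ^+ N * c1) = (u t ^+ N == c1).
  rewrite /u [in RHS]exprMn exprVn -[RHS](inj_eq (mulfI (expf_neq0 N e10))).
  by rewrite mulrCA divff ?expf_neq0 // mulr1.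
have R0 : realizes [seq Avg (2 ^ s)%N
               (fun j => (1 + e) ^- j *
                         (eps k.+1 ^- (i * j) + e ^+ j * eps k.+1 ^+ (i * j))) y
          | i <- index_iota 0 (2 ^ k.+1)]
    (fun t => u t ^+ (2 ^ 1 * 2 ^ k.+1) == 1%R).
  have := @realizes_coset_pairs 0 (2 ^ k.+1) (eps k.+1) (1 + e) ((1 + e) * e^-1)
    (fun i j => (1 + e) ^- j * (eps k.+1 ^- (i * j) + e ^+ j * eps k.+1 ^+ (i * j))).
  rewrite !subn0 !addn0 expn0 expr1 => H.
  apply: realizes_ext (H _ _ _ _ _ _ _ _ _) _ => // {H}.
  - exact: eps_prim.
  - by rewrite eps_one // ltnW.
  - by rewrite exprMn exprVn eM invrN invr1 mulrN1.
  - move=> i j; rewrite mulrDr !exprMn !exprVn !invfM !invrK -!exprM.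
    by rewrite mulrA.
  - by move=> t _; rewrite expr1 -[X in _ == X]mulr1 uE mulnC.
(* The index of the third list is shifted by one; for k = 0 that list is empty
   whether or not its guard holds. *)
have R1 : realizes
       ((if (k.+2 + 1 <= s)%N then
          [:: Avg (2 ^ (s - 1))%N (fun j => d ^- j) y1;
              Avg (2 ^ (s - 1))%N (fun j => (-1) ^+ j * d ^- j) y1]
         else [::]) ++
        (if (k.+2 + 1 <= s)%N && (3 <= k.+2)%N then
          [seq Avg (2 ^ (s - 1))%N
                 (fun j => d ^- j * (eps k.+1 ^- (j * (1 + i))
                                     + eps k.+1 ^+ (j * (1 + i)))) y1
            | i <- index_iota 0 (2 ^ k - 1)]
         else [::]))
    (fun t => if (k.+2 + 1 <= s)%N then (u t ^+ (2 ^ 1 * 2 ^ k.+1) == (-1)%R) : nat else 0%N).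
  case: ifP => [k1s|_]; last exact: realizes_nil.
  have s1 : (1 <= s)%N by rewrite (leq_trans _ ks).
  rewrite addn1 in k1s.
  have -> : (if true && (3 <= k.+2)%N then
          [seq Avg (2 ^ (s - 1))%N
                 (fun j => d ^- j * (eps k.+1 ^- (j * (1 + i))
                                     + eps k.+1 ^+ (j * (1 + i)))) y1
            | i <- index_iota 0 (2 ^ k - 1)]
         else [::]) = [seq Avg (2 ^ (s - 1))%N
                 (fun j => d ^- j * (eps k.+1 ^- (j * i) + eps k.+1 ^+ (j * i))) y1
            | i <- index_iota 1 (2 ^ k)].
    have -> : index_iota 1 (2 ^ k) = [seq (1 + i)%N | i <- index_iota 0 (2 ^ k - 1)].
      by rewrite /index_iota subn0 -iotaDl.
    rewrite -map_comp; case: ifP => //; rewrite ltnS ltnS.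
    by case: (k).
  have H := @realizes_inverse_pairs 1 k (2%:R + c) (fun j => d ^- j)
    (fun j => (-1) ^+ j * d ^- j)
    (fun i j => d ^- j * (eps k.+1 ^- (j * i) + eps k.+1 ^+ (j * i))).
  rewrite -dK in H.
  apply: realizes_ext (H _ _ _ _ _ _ _ _) _ => // {H}.
  - by rewrite ltn_subRL add1n (leq_trans _ k1s).
  - rewrite -aE' dE exprMn -exprM -expnS subn1 prednK // exprVn -subn1.
    by rewrite eps_one ?invr1 ?mulr1 // leq_subRL // add1n.
  - move=> _ w v w1 Lv; rewrite dE -mulrA; apply: adjoin_nonsquare_scale Lv => //.
      exact: conj_pair_adjoin e1_conj.
    by move=> v' ; apply: nsq; rewrite exprMn w1 exprVn eM invrN invr1 mulr1.
  - by move=> j; rewrite -[- d]mulN1r exprMn invfM; congr (_ * _); rewrite -exprVn invrN invr1.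
  - move=> i j; rewrite mulrDr !exprMn !exprVn !invfM !invrK -!exprM.
    by rewrite (mulnC j).
  - move=> t _; rewrite dE [(_ ^+ 2 / e) ^+ _]exprMn exprVn eM invrN invr1 -!exprM.
    by rewrite uE.
have R2 : realizes
        (if (k.+2 + 2 <= s)%N then
          [seq Avg (2 ^ (s - r))%N
                 (fun j => (1 + eps k.+2) ^- (j * 2 ^ r) *
                           (eps k.+2 ^- j * eps k ^- (i * j)
                            + eps k.+2 ^+ j * eps k ^+ (j * (i + 2 ^ (r - 2)))))
                 (b ^- (2 ^ r) *: x ^+ (2 ^ (n - s + r)))
            | r <- index_iota 2 (s - k.+2).+1, i <- index_iota 0 (2 ^ k)]
         else [::])
    (fun t => \sum_(r <- index_iota 2 (s - k.+2).+1) (u t ^+ (2 ^ r * 2 ^ k.+1) == (-1)%R))%N.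
  case: ifP => [_|ks2]; last first.
    apply: realizes_ext (realizes_nil _ _ _ _) _ => t _.
    rewrite /index_iota (_ : _ - 2 = 0)%N ?big_nil //.
    apply/eqP; rewrite subn_eq0 ltnS leq_subLR -ltnS -addnS ltnNge.
    by rewrite ks2.
  apply: realizes_allpairs => r; rewrite mem_index_iota ltnS => /andP[r2 rs].
  have r_le : (r <= s)%N by rewrite (leq_trans rs) ?leq_subr.
  have srk : (k.+2 <= s - r)%N by rewrite leq_subCr.
  have H := @realizes_coset_pairs r (2 ^ k) (eps k) ((1 + e) ^+ (2 ^ r) * e)
     (((1 + e) * e^-1) ^+ (2 ^ r) * e^-1) (fun i j => (1 + eps k.+2) ^- (j * 2 ^ r) *
                           (eps k.+2 ^- j * eps k ^- (i * j)
                            + eps k.+2 ^+ j * eps k ^+ (j * (i + 2 ^ (r - 2))))).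
  have eq_r : (2 ^ r = 2 ^ 2 * 2 ^ (r - 2))%N by rewrite -expnD subnKC.
  have e_r : e ^+ (2 ^ r) = eps k ^+ (2 ^ (r - 2)).
    by rewrite eq_r exprM /e -(epsX eps_compatible 2 k) addn2.
  apply: realizes_ext (H _ _ _ _ _ _ _ _ _) _ => // {H}.
  - exact: eps_prim.
  - by apply: eps_one; apply: leq_trans (leqnSn _) (ltnW srk).
  - exact: (conj_pairM i2 (conj_pairX i2 (2 ^ r) e1_conj) e_conj).
  - rewrite exprMn (eps_conj_pow e_conj) mulrN [in RHS]exprMn; congr (- (_ * _)).
    rewrite exprMn exprVn e_r exprMn exprVn -[X in _ / X]exprM mulnC exprM.
    by rewrite (prim_expr_order (eps_prim eps_compatible k)) expr1n divr1.
  - by rewrite exprMn -exprM -expnD subnKC // eps_one // mulr1.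
  - move=> r0 j v Lv; rewrite -(prednK r0) expnSr exprM -mulrA.
    apply: adjoin_nonsquare_scale Lv.
    + exact: conj_pair_adjoin (conj_pairX i2 (2 ^ r.-1) e1_conj).
    + exact: expf_neq0.
    move=> v'; apply: nsq; rewrite exprMn eM -exprM mulnC exprM eps_one //.
    by rewrite expr1n mulr1.
  - move=> i j; rewrite -/e [((1 + e) / e) ^+ _]exprMn exprVn e_r mulnDr exprD.
    rewrite !exprMn !exprVn !invfM !invrK -!exprM.
    rewrite (mulnC j (2 ^ r)%N) (mulnC j i) (mulnC j (2 ^ (r - 2))%N).
    by ring.
  - move=> t _; rewrite -expnSr [(_ * e) ^+ _]exprMn eM -!exprM.
    by rewrite uE.
rewrite [X in _ ++ X]catA; apply: realizes_ext (realizes_cat R0 (realizes_cat R1 R2)) _ => t tN.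
have uS : u t ^+ (2 ^ (s - k.+2).+1 * 2 ^ k.+1) = 1.
  by rewrite -expnD addSnnS subnK // div_tau.
have := sum_expN1 (u t) (2 ^ k.+1) two_neq0 (isT : (1 <= (s - k.+2).+1)%N).
rewrite uS eqxx /= => tot; rewrite -[RHS]tot; congr (_ + _)%N.
case: ifP => ks1; first by rewrite [RHS]big_ltn // ltnS subn_gt0 -addn1.
rewrite add0n big_geq; last by rewrite ltnS leq_subLR addn1 ltnW // ltnNge -addn1 ks1.
by rewrite big_geq // ltnS leq_subLR addn0 -ltnS ltnNge -addn1 ks1.
Qed.
End Blocks.

Theorem theorem3
  (K : fieldType) (Kbar : closedFieldType) (emb : {rmorphism K -> Kbar})
  (Kbar_algebraic : forall z : Kbar, algebraicOver emb z)
  (eps : nat -> Kbar) (eps_compatible : compatible_roots eps)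
  (charK : 2 \notin [pchar K])
  (K_neq : base_neq_adjoin_eps2 emb eps)
  (n : nat) (gT : finGroupType) (G : {group gT}) (g : gT)
  (G_cyclic : G :=: <[g]>%g) (G_order : #|G| = (2 ^ n)%N)
  (A : falgType K) (bar : gT -> A)
  (A_twisted : is_twisted_group_algebra G bar)
  (a : K) (a_neq0 : a != 0) (bar_g : bar g ^+ (2 ^ n) = a%:A)
  (s : nat) (height_a : height_eq emb eps n a s) :
  [/\
    (* 1 *)
    s = 0%N -> forall e : A, minimal_idempotent e <-> e = 1,
    (* 2 *)
    forall b : K, b != 0 -> a = b ^+ (2 ^ s) ->
      (typeC emb eps /\ (1 <= s)%N) \/
      (exists m, (typeD emb eps m \/ typeE emb eps m) /\ (1 <= s <= m - 1)%N) ->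
      let y := b^-1 *: bar g ^+ (2 ^ (n - s)) in
      minimal_idempotents_are emb (
        [:: Avg (2 ^ s)%N (fun j => 1) y;
            Avg (2 ^ s)%N (fun j => (-1) ^+ j) y] ++
        [seq Avg (2 ^ s)%N
               (fun j => eps s ^+ (i * j) + eps s ^- (i * j)) y
          | i <- index_iota 1 (2 ^ (s - 1))]),
    (* 3 *)
    forall (m : nat) (lambda : Kbar) (b : K),
      (typeD emb eps m /\ lambda = 1) \/ (typeE emb eps m /\ lambda = -1) ->
      (m <= s)%N -> b != 0 -> a = b ^+ (2 ^ s) ->
      let y := b^-1 *: bar g ^+ (2 ^ (n - s)) in
      minimal_idempotents_are emb (
        [:: Avg (2 ^ s)%N (fun j => 1) y;
            Avg (2 ^ s)%N (fun j => (-1) ^+ j) y] ++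
        [seq Avg (2 ^ s)%N
               (fun j => eps (m - 1)%N ^+ (i * j) + eps (m - 1)%N ^- (i * j)) y
          | i <- index_iota 1 (2 ^ (m - 2))] ++
        [seq Avg (2 ^ (s - r))%N
               (fun j => eps m ^- j * eps (m - 2)%N ^- (i * j)
                         + lambda ^- j * eps m ^+ j * eps (m - 2)%N ^+ (i * j))
               (b ^- (2 ^ r) *: bar g ^+ (2 ^ (n - s + r)))
          | r <- index_iota 0 (s - m).+1, i <- index_iota 0 (2 ^ (m - 2))]),
    (* 4 *)
    forall (lambda : Kbar) (b : K), b != 0 -> a = - b ^+ (2 ^ s) ->
      (typeC emb eps /\ (1 <= s)%N) \/
      (exists m, (typeD emb eps m \/ typeE emb eps m) /\ (1 <= s <= m - 1)%N) ->
      ((exists m, typeE emb eps m /\ s = (m - 1)%N) /\ lambda = -1) \/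
      (~ (exists m, typeE emb eps m /\ s = (m - 1)%N) /\ lambda = 1) ->
      let y := b^-1 *: bar g ^+ (2 ^ (n - s)) in
      minimal_idempotents_are emb
        [seq Avg (2 ^ s)%N
               (fun j => eps s.+1 ^- j * eps (s - 1)%N ^- (i * j)
                         + lambda ^- j * eps s.+1 ^+ j * eps (s - 1)%N ^+ (i * j))
               y
          | i <- index_iota 0 (2 ^ (s - 1))]
  & (* 5 *)
    forall (m : nat) (b : K),
      typeD emb eps m -> (m <= s)%N -> b != 0 ->
      emb a = emb b ^+ (2 ^ s) * (1 + eps m) ^+ (2 ^ s) ->
      let y := b^-1 *: bar g ^+ (2 ^ (n - s)) in
      let y1 := b ^- 2 *: bar g ^+ (2 ^ (n - s + 1)) in
      let d := 2%:R + eps m + (eps m)^-1 in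
      minimal_idempotents_are emb (
        [seq Avg (2 ^ s)%N
               (fun j => (1 + eps m) ^- j *
                         (eps (m - 1)%N ^- (i * j)
                          + eps m ^+ j * eps (m - 1)%N ^+ (i * j))) y
          | i <- index_iota 0 (2 ^ (m - 1))] ++
        (if (m + 1 <= s)%N then
          [:: Avg (2 ^ (s - 1))%N (fun j => d ^- j) y1;
              Avg (2 ^ (s - 1))%N (fun j => (-1) ^+ j * d ^- j) y1]
         else [::]) ++
        (if (m + 1 <= s)%N && (3 <= m)%N then
          [seq Avg (2 ^ (s - 1))%N
                 (fun j => d ^- j * (eps (m - 1)%N ^- (j * (1 + i))
                                     + eps (m - 1)%N ^+ (j * (1 + i)))) y1
            | i <- index_iota 0 (2 ^ (m - 2) - 1)]
         else [::]) ++
        (if (m + 2 <= s)%N then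
          [seq Avg (2 ^ (s - r))%N
                 (fun j => (1 + eps m) ^- (j * 2 ^ r) *
                           (eps m ^- j * eps (m - 2)%N ^- (i * j)
                            + eps m ^+ j * eps (m - 2)%N ^+ (j * (i + 2 ^ (r - 2)))))
                 (b ^- (2 ^ r) *: bar g ^+ (2 ^ (n - s + r)))
            | r <- index_iota 2 (s - m).+1, i <- index_iota 0 (2 ^ (m - 2))]
         else [::]))].
Proof.
have two_neq0 : 2%:R != 0 :> Kbar.
  by rewrite -(rmorph_nat emb) fmorph_eq0; apply: contra charK => two_neq0; rewrite inE /= two_neq0.
have i_notin : ~ in_base emb (eps 2%N).
  case=> c ic; apply: K_neq => z; split=> [[z' ->]|[p [q [_ ->]]]].
    exists z'%:P, 1; rewrite rmorph1 map_polyC !hornerC oner_neq0 divr1.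
    by split.
  by exists (p.[c] / q.[c]); rewrite ic !horner_map fmorph_div.
have [s_le_n _ s_max] := height_a.
have height_max : (s < n)%N -> forall v, adjoin_sqrt (in_base emb) (eps 2%N) v ->
    v ^+ (2 ^ s.+1) <> emb a.
  move=> sn v [_ [_ [[u1 ->] [u2 ->] vE]]] va.
  have v0 : v != 0.
    by apply: contra_neq a_neq0 => v0; apply/eqP; rewrite -(fmorph_eq0 emb) -va v0 expr0n expn_eq0.
  suff /(s_max _ sn) : in_Ks emb eps s.+1 a by rewrite ltnn.
  split=> //; exists v; split=> //.
  exists (u1%:P + u2 *: 'X), 1; rewrite rmorph1 hornerC oner_neq0 divr1; split=> //.
  by rewrite rmorphD /= map_polyC map_polyZ map_polyX /= hornerD hornerC hornerZ hornerX.
have x_basis : basis_of {:A}%VS [seq bar g ^+ j | j <- iota 0 (2 ^ n)].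
  by rewrite -G_order; apply: twisted_power_basis A_twisted a_neq0 _; rewrite ?G_order.
have N_gt0 : (0 < 2 ^ n)%N by rewrite expn_gt0.
have minimal := realizes_minimal (emb := emb) N_gt0 a_neq0 (eps_prim eps_compatible n) x_basis bar_g.
split.
- move=> s0 e; rewrite s0 in height_max.
  (* With beta = 1 and b = a the single averaging formula has one term, the unit. *)
  have R := realizes_single eps_compatible two_neq0 i_notin (bar g) a_neq0 a_neq0 (leq0n n)
    height_max (r := 0) (c := 1) (coef := fun=> 1) (leqnn 0).
  have [|es [es_den _ ->]] := minimal [:: Avg (2 ^ 0) (fun=> 1) (a ^- (2 ^ 0) *: bar g ^+ (2 ^ (n - 0 + 0)))] _.
    apply: realizes_ext (R _ _ _) _ => //.
    - by rewrite rmorph1 !expr1 mul1r.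
    - by move=> j; rewrite rmorph1 expr1n invr1.
    - by move=> t tN; rewrite subn0 tN divff ?fmorph_eq0 // rmorph1 eqxx.
  case: es es_den => [|e1 es] es_den; first by have := List.Forall2_length es_den.
  have [den tl] : denotes emb (Avg (2 ^ 0) (fun=> 1) (a ^- (2 ^ 0) *: bar g ^+ (2 ^ (n - 0 + 0)))) e1
    /\ List.Forall2 (@denotes K Kbar emb A) [::] es.
    by inversion es_den.
  have -> : es = [::] by inversion tl.
  have [c [/(_ 0%N isT) /= c1 ->]] := den; rewrite inE.
  have c1' : c 0%N = 1 by apply: (fmorph_inj emb); rewrite c1 rmorph1.
  rewrite big_ord1 /= c1' expr0 scale1r invr1 scale1r; split; first by move/eqP.
  by move->.
- move=> b b0 aE types y; apply: minimal.
  have [s0 s_conj] : (0 < s)%N /\ conj_pair emb (eps 2%N) (eps s) (eps s)^-1.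
    case: types => [[tC s0]|[m [mDE /andP[s0 sm]]]]; split=> //.
      exact: (conj_pair_eps eps_compatible i_notin (tC s)).
    exact: (conj_pair_eps_le eps_compatible sm (typeDE_conj_pred eps_compatible i_notin mDE)).
  exact: realizes_power_split.
- move=> m lambda b lam ms b0 aE y; apply: minimal.
  have mDE : typeD emb eps m \/ typeE emb eps m.
    by case: lam => -[]; [left | right].
  have m_conj : conj_pair emb (eps 2%N) (eps m) (lambda * (eps m)^-1).
    case: lam => -[]=> [mD ->|mE ->]; first by rewrite mul1r; apply: typeD_conj.
    by rewrite mulN1r; apply: typeE_conj.
  have m2 : (2 <= m)%N by case: mDE => -[] // /ltnW.
  move: m m2 {lam} ms mDE m_conj => [|[|k]] // _ ks mDE k_conj.
  rewrite subn1 subn2 /=.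
  exact: realizes_power_nonsplit.
- move=> lambda b b0 aE types lam y; apply: minimal.
  have [s0 [s_conj s1_conj]] : (0 < s)%N /\
      conj_pair emb (eps 2%N) (eps s.+1) (lambda * (eps s.+1)^-1) /\
      conj_pair emb (eps 2%N) (eps (s - 1)%N) (eps (s - 1)%N)^-1.
    split; last split.
    + by case: types => [[]|[m [_ /andP[]]]].
    + case: lam => -[].
        by case=> m [mE sE] ->; rewrite mulN1r sE subn1 prednK; [exact: typeE_conj | by case: mE => /ltnW/ltnW].
      move=> not_mE ->; rewrite mul1r.
      case: types => [[tC _]|[m [mDE /andP[s0 sm]]]]; first exact: (conj_pair_eps eps_compatible i_notin (tC s.+1)).
      have m0 : (0 < m)%N by case: (m) sm s0 => //; case: (s).
      case: mDE => [mD|mE].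
        apply: (conj_pair_eps_le eps_compatible) (typeD_conj eps_compatible i_notin mD) => //.
        by rewrite -(subnK m0) addn1 ltnS.
      apply: (conj_pair_eps_le eps_compatible) (typeE_conj_pred eps_compatible i_notin mE) => //.
      rewrite ltn_neqAle sm andbT; apply/eqP=> sE.
      by apply: not_mE; exists m.
    case: types => [[tC _]|[m [mDE /andP[s0 sm]]]]; first exact: (conj_pair_eps eps_compatible i_notin (tC (s - 1)%N)).
    apply: (conj_pair_eps_le eps_compatible) (typeDE_conj_pred eps_compatible i_notin mDE) => //.
    by rewrite (leq_trans _ sm) // leq_subr.
  exact: realizes_opp_power.
- move=> m b mD ms b0 aE y y1 d; apply: minimal.
  have m2 : (2 <= m)%N by case: mD.
  move: m m2 ms mD aE @d => [|[|k]] // _ ks kD aE d.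
  rewrite subn1 subn2 /=.
  exact: realizes_shifted_power.
Qed.
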